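(* Let $g\colon\mathbb{R}^d\to\mathbb{R}$ satisfy Assumptions (A1) and (A2) (with constants $L_1$ and $\alpha,\beta,L_2$), and let $G\colon\mathbb{R}^d\to\mathbb{R}^d$ be a (Borel measurable) $(a,b)$-inexact gradient oracle for $g$. Fix $x_0\in\mathbb{R}^d$, $\Delta_g\ge g(x_0)-\inf g$, and $\delta\in(0,1)$, $\varepsilon_1\in(0,\alpha)$, $\varepsilon_2\in(0,\min\{4\gamma\beta L_2,\,L_1,\,L_1^2\})$. Suppose $$a\le \min\Big\{\tfrac{1}{20},\ \tfrac{1}{L_1\eta M 2^{\gamma+2}},\ \tfrac{R}{\varepsilon_1\eta M 2^{\gamma+2}}\Big\},\qquad b\le\min\Big\{\tfrac{\varepsilon_1}{64},\ \big(\tfrac{F}{40\eta M}\big)^{1/2},\ \big(\tfrac{L_1F}{M(5L_1+1)}\big)^{1/2},\ \tfrac{R}{M\eta 2^{\gamma+2}}\Big\},$$ with $\gamma,F,R,\eta,M$ the parameters defined in the context. Let $$T=8\Delta_g\max\Big\{\frac{2M}{F},\ \frac{256}{(1-a)\eta\varepsilon_1^2}\Big\}+4M$$ (rounded up to an integer). Then with probability at least $1-\delta$, at least one of the iterates $x_0,x_1,\dots,x_T$ generated by Algorithm PIGD with parameters $(\eta,r,M,\varepsilon_1)$ and oracle $G$ is an $(\varepsilon_1,\varepsilon_2)$-second-order critical point of $g$.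
   Context: Assumption (A1): $g\colon\mathbb{R}^d\to\mathbb{R}$ is bounded below and $\|\nabla g(x)-\nabla g(y)\|\le L_1\|x-y\|$ for all $x,y$. Assumption (A2): there are constants $\alpha,\beta,L_2>0$ such that for every $\bar x$ with $\|\nabla g(\bar x)\|\le\alpha$, $g$ is $C^2$ on the closed ball $\mathbb{B}_\beta(\bar x)$ and $\|\nabla^2g(x)-\nabla^2 g(y)\|\le L_2\|x-y\|$ for all $x,y\in\mathbb{B}_\beta(\bar x)$. A map $G\colon\mathbb{R}^d\to\mathbb{R}^d$ is an $(a,b)$-inexact gradient oracle for $g$ if $\|\nabla g(x)-G(x)\|\le a\|\nabla g(x)\|+b$ for all $x$. A point $x$ is an $(\varepsilon_1,\varepsilon_2)$-second-order critical point of $g$ if $\|\nabla g(x)\|\le\varepsilon_1$ and $\lambda_{\min}(\nabla^2 g(x))\ge-\varepsilon_2$. Parameters: $\phi:=2^{24}\max\{1,5\frac{L_2\varepsilon_1}{L_1\varepsilon_2}\}\frac{L_1^2}{\delta}\sqrt d\big(\Delta_g\max\{\frac{L_2^2}{\varepsilon_2^5},\frac{1}{\varepsilon_1^2\varepsilon_2}\}+\frac{1}{\varepsilon_2^2}\big)$, $\gamma:=\log_2(\phi(\log_2\phi)^8)$, $F:=\frac{1}{800\gamma^3}\frac{1-a}{(1+a)^2}\frac{\varepsilon_2^3}{L_2^2}$, $R:=\frac{1}{4\gamma}\frac{\varepsilon_2}{L_2}$, $\eta:=\frac{1-a}{(1+a)^2}\frac{1}{L_1}$, $r:=\frac{\varepsilon_2^2}{400L_2\gamma^3}\min\{1,\frac{L_1\varepsilon_2}{5\varepsilon_1L_2}\}$,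 $M:=\frac{(1+a)^2}{1-a}\frac{L_1}{\varepsilon_2}\gamma$. Algorithm PIGD: set $t_{\rm pert}=-M$. For $t=0,1,\dots,T$: set $u_t=0$; if $\|G(x_t)\|\le\varepsilon_1/2$ and $t-t_{\rm pert}\ge M$, set $t_{\rm pert}=t$ and draw $u_t$ uniformly from the ball $r\mathbb{B}=\{u:\|u\|\le r\}$, independently of everything else; then set $x_{t+1}=x_t-\eta(G(x_t)+u_t)$. *)

(* Defs.v *)
From HB Require Import structures.
From mathcomp Require Import all_boot all_order all_algebra.
From mathcomp Require Import all_classical all_reals all_analysis.
Set Implicit Arguments.
Unset Strict Implicit.
Unset Printing Implicit Defensive.
Import Order.TTheory GRing.Theory Num.Theory.
Import numFieldNormedType.Exports.
Local Open Scope classical_set_scope.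
Local Open Scope ring_scope.

Section Defs.
Variables (R : realType) (d : nat).

(* Euclidean norm on R^d (the library norm on matrices is the max-norm). *)
Definition enorm (v : 'rV[R]_d) : R := Num.sqrt (\sum_(i < d) v 0 i ^+ 2).

Definition e_ (i : 'I_d) : 'rV[R]_d := delta_mx 0 i.

Definition grad (g : 'rV[R]_d -> R^o) (x : 'rV[R]_d) : 'rV[R]_d :=
  \row_i ('D_(e_ i) g x).

Definition hess (g : 'rV[R]_d -> R^o) (x : 'rV[R]_d) : 'M[R]_d :=
  \matrix_(i, j) (('D_(e_ j) (grad g) x) 0 i).

Definition opnorm (A : 'M[R]_d) : R :=
  sup [set enorm ((A *m v^T)^T) | v in [set v : 'rV[R]_d | enorm v <= 1]].

Definition cball (c : 'rV[R]_d) (rad : R) : set 'rV[R]_d :=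
  [set x | enorm (x - c) <= rad].

Definition assumption_A1 (g : 'rV[R]_d -> R^o) (L1 : R) : Prop :=
  (exists m : R, forall x, m <= g x) /\
  (forall x, differentiable g x) /\
  (forall x y, enorm (grad g x - grad g y) <= L1 * enorm (x - y)).

Definition assumption_A2 (g : 'rV[R]_d -> R^o) (alpha beta L2 : R) : Prop :=
  forall xb, enorm (grad g xb) <= alpha ->
    [/\ forall x, cball xb beta x -> differentiable (grad g) x,
        {within cball xb beta, continuous (hess g)} &
        forall x y, cball xb beta x -> cball xb beta y ->
          opnorm (hess g x - hess g y) <= L2 * enorm (x - y)].

Definition inexact_oracle (g : 'rV[R]_d -> R^o) (G : 'rV[R]_d -> 'rV[R]_d)
    (a b : R) : Prop :=
  forall x, enorm (grad g x - G x) <= a * enorm (grad g x) + b.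

Definition borel_measurable (G : 'rV[R]_d -> 'rV[R]_d) : Prop :=
  forall A : set 'rV[R]_d, open A -> <<s open >> (G @^-1` A).

Definition lambda_min_ge (H : 'M[R]_d) (c : R) : Prop :=
  forall lam : R, eigenvalue H lam -> c <= lam.

Definition second_order_critical (g : 'rV[R]_d -> R^o) (eps1 eps2 : R)
    (x : 'rV[R]_d) : Prop :=
  enorm (grad g x) <= eps1 /\ lambda_min_ge (hess g x) (- eps2).

(* Iterated Lebesgue integral of a nonnegative function on R^k (coordinate
   by coordinate); by Tonelli this is the integral w.r.t. the
   k-dimensional Lebesgue measure for measurable nonnegative f. *)
Fixpoint iint (k : nat) : ('rV[R]_k -> \bar R) -> \bar R :=
  match k with
  | 0 => fun f => f 0
  | k'.+1 => fun f =>
      (\int[@lebesgue_measure R]_t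
          iint (fun v : 'rV[R]_k' => f (row_mx (\row_(_ < 1) t) v)))%E
  end.

Definition unif_ball_avg (rad : R) (h : 'rV[R]_d -> \bar R) : \bar R :=
  ((fine (iint (fun v => (\1_(cball 0 rad) v)%:E)))^-1%:E *
   iint (fun v => (\1_(cball 0 rad) v)%:E * h v))%E.

(* Expectation of F(U_0,U_1,...) where U_0,...,U_{k-1} are i.i.d. uniform
   on the closed ball r B (coordinates >= k are irrelevant, set to 0). *)
Fixpoint unif_ball_seq_exp (rad : R) (k : nat)
    (F : (nat -> 'rV[R]_d) -> \bar R) : \bar R :=
  match k with
  | 0 => F (fun _ => 0)
  | k'.+1 => unif_ball_seq_exp rad k'
      (fun w => unif_ball_avg rad
         (fun u => F (fun n => if n == k' then u else w n)))
  end.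

Definition unif_ball_seq_prob (rad : R) (k : nat)
    (E : set (nat -> 'rV[R]_d)) : \bar R :=
  unif_ball_seq_exp rad k (fun w => (\1_E w)%:E).

(* State after n steps: (x_n, t_pert).  w n is the uniform draw from r B
   that is used at step n if a perturbation is triggered there. *)
Fixpoint pigd_state (G : 'rV[R]_d -> 'rV[R]_d) (eta M eps1 : R)
    (x0 : 'rV[R]_d) (w : nat -> 'rV[R]_d) (n : nat) : 'rV[R]_d * R :=
  match n with
  | 0 => (x0, - M)
  | n'.+1 =>
      let st := pigd_state G eta M eps1 x0 w n' in
      let x := st.1 in
      let tp := st.2 in
      let pert := (enorm (G x) <= eps1 / 2) && (M <= n'%:R - tp) in
      (x - eta *: (G x + (if pert then w n' else 0)),
       if pert then n'%:R else tp)
  end.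

Definition pigd_iterate G eta M eps1 x0 w n : 'rV[R]_d :=
  (pigd_state G eta M eps1 x0 w n).1.

End Defs.

Section Params.
Variable R : realType.

Definition log2 (x : R) : R := ln x / ln 2.

Definition phi_par (d : nat) (L1 L2 eps1 eps2 delta Dg : R) : R :=
  2 ^+ 24 * Num.max 1 (5 * (L2 * eps1) / (L1 * eps2)) * (L1 ^+ 2 / delta)
  * Num.sqrt d%:R
  * (Dg * Num.max (L2 ^+ 2 / eps2 ^+ 5) (1 / (eps1 ^+ 2 * eps2))
     + 1 / eps2 ^+ 2).

Definition gamma_par (phi : R) : R := log2 (phi * (log2 phi) ^+ 8).

Definition F_par (gamma a L2 eps2 : R) : R :=
  1 / (800 * gamma ^+ 3) * ((1 - a) / (1 + a) ^+ 2) * (eps2 ^+ 3 / L2 ^+ 2).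

Definition R_par (gamma L2 eps2 : R) : R := 1 / (4 * gamma) * (eps2 / L2).

Definition eta_par (a L1 : R) : R := (1 - a) / (1 + a) ^+ 2 * (1 / L1).

Definition r_par (gamma L1 L2 eps1 eps2 : R) : R :=
  eps2 ^+ 2 / (400 * L2 * gamma ^+ 3)
  * Num.min 1 (L1 * eps2 / (5 * eps1 * L2)).

Definition M_par (gamma a L1 eps2 : R) : R :=
  (1 + a) ^+ 2 / (1 - a) * (L1 / eps2) * gamma.

Definition T_par (Dg M F a eta eps1 : R) : nat :=
  `| Num.ceil (8 * Dg * Num.max (2 * M / F) (256 / ((1 - a) * eta * eps1 ^+ 2))
               + 4 * M) |%N.

End Params.

(* Main.v *)
(* At an iterate with a large inexact gradient one step lowers g by a fixed rate.
   At a strict saddle x, call a perturbation u stuck if the next N = ceil M steps do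
   not lower g by F. A stuck run stays in a ball of radius 3 R / 5 around x, where
   the dynamics is close to its linearization; two stuck runs whose perturbations
   differ by s v, v being an eigenvector of the least Hessian eigenvalue, would
   separate exponentially fast and leave this ball unless |s| is below a threshold
   w of order 2^-gamma. The set of stuck perturbations is thus thin in the
   direction v, so that disjoint translates of it along v fit in a ball of
   comparable volume: its relative volume is at most p = 4 w sqrt d / r. If no
   perturbation drawn at a saddle is stuck and no iterate is critical, g decreases
   at a rate that brings it below its infimum after T0 <= T steps; by the choice of
   gamma, p T0 <= delta. *)

(* The final event and the averages over the draws are not known to be measurable, so probabilities
   are only bounded from below, by comparison with measurable sets: the stuck set of one fixed
   starting point is Borel because [G] is Borel and [g] continuous. Draws are indexed by steps, not
   by epochs. A step that triggers nothing has an empty bad set, and each of the first [T0] steps is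
   charged [p], so no count of epochs is needed. The constants interlock. With threshold
   [w = 5 Rr / (2 ^ gamma eta)], two coupled runs start [5 Rr / 2 ^ gamma] apart after the first
   step. The growth over the remaining steps is at least [2 ^ gamma / 2], one step being lost, which
   makes [5 / 2 Rr]. Two confined runs allow at most [4 * (3 / 5) Rr = 12 / 5 Rr], where half of the
   growth is conceded to the oracle and Hessian errors. The parameter [M] is tuned so that
   [eta eps2 M = gamma], and [F] so that [M F = L1 Rr^2 / 50], which yields the radius
   [3 / 5 Rr]. *)
Require Import Defs.
From HB Require Import structures.
From mathcomp Require Import all_boot all_order all_algebra.
From mathcomp Require Import all_classical all_reals all_analysis.
From mathcomp Require Import measurable_realfun.
From mathcomp Require Import ring lra.
Set Implicit Arguments.
Unset Strict Implicit.
Unset Printing Implicit Defensive.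
Import Order.TTheory GRing.Theory Num.Theory.
Import numFieldNormedType.Exports.
Local Open Scope classical_set_scope.
Local Open Scope ring_scope.

(** * Euclidean geometry of row vectors *)

Section Euclid.
Context {R : realType} {d : nat}.
Implicit Types u v w : 'rV[R]_d.

Definition dot u v : R := \sum_(i < d) u 0 i * v 0 i.

Lemma dotC u v : dot u v = dot v u.
Proof. by apply: eq_bigr => i _; rewrite mulrC. Qed.

Lemma dotDl u v w : dot (u + v) w = dot u w + dot v w.
Proof. by rewrite /dot -big_split; apply: eq_bigr => i _; rewrite mxE mulrDl. Qed.

Lemma dotZl k u v : dot (k *: u) v = k * dot u v.
Proof. by rewrite /dot mulr_sumr; apply: eq_bigr => i _; rewrite mxE mulrA. Qed.

Lemma dotNl u v : dot (- u) v = - dot u v.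
Proof. by rewrite -scaleN1r dotZl mulN1r. Qed.

Lemma dotBl u v w : dot (u - v) w = dot u w - dot v w.
Proof. by rewrite dotDl dotNl. Qed.

Lemma dotDr u v w : dot u (v + w) = dot u v + dot u w.
Proof. by rewrite dotC dotDl 2!(dotC u). Qed.

Lemma dotZr k u v : dot u (k *: v) = k * dot u v.
Proof. by rewrite dotC dotZl dotC. Qed.

Lemma dotNr u v : dot u (- v) = - dot u v.
Proof. by rewrite dotC dotNl dotC. Qed.

Lemma dotBr u v w : dot u (v - w) = dot u v - dot u w.
Proof. by rewrite dotDr dotNr. Qed.

Lemma dot0l u : dot 0 u = 0.
Proof. by rewrite -(scale0r u) dotZl mul0r. Qed.

Lemma dot0r u : dot u 0 = 0.
Proof. by rewrite dotC dot0l. Qed.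

Lemma dot_e u i : dot u (e_ R i) = u 0 i.
Proof.
rewrite /dot (bigD1 i)//= big1 ?addr0 ?mxE ?eqxx ?mulr1// => j ji.
by rewrite !mxE (negbTE ji) andbF mulr0.
Qed.

Lemma dotvv_ge0 u : 0 <= dot u u.
Proof. by apply: sumr_ge0 => i _; rewrite -expr2 sqr_ge0. Qed.

Lemma enormE u : enorm u = Num.sqrt (dot u u).
Proof. by []. Qed.

Lemma enorm_ge0 u : 0 <= enorm u.
Proof. exact: sqrtr_ge0. Qed.

Lemma sqr_enorm u : enorm u ^+ 2 = dot u u.
Proof. by rewrite enormE sqr_sqrtr// dotvv_ge0. Qed.

Lemma enorm0 : enorm (0 : 'rV[R]_d) = 0.
Proof. by rewrite enormE dot0l sqrtr0. Qed.

Lemma enorm0_eq0 u : enorm u = 0 -> u = 0.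
Proof.
move=> u0; have := sqr_enorm u; rewrite u0 expr0n/= => /esym/eqP.
rewrite psumr_eq0 => [/allP h|i _]; last by rewrite -expr2 sqr_ge0.
apply/rowP => i; rewrite mxE; have /= := h i (mem_index_enum _).
by rewrite mulf_eq0 orbb => /eqP.
Qed.

Lemma enorm_gt0 u : u != 0 -> 0 < enorm u.
Proof.
move=> u0; rewrite lt_def enorm_ge0 andbT.
by apply: contra u0 => /eqP/enorm0_eq0 ->.
Qed.

Lemma dot_le u v : dot u v <= enorm u * enorm v.
Proof.
have [->|v0] := eqVneq v 0; first by rewrite dot0r enorm0 mulr0.
have [->|u0] := eqVneq u 0; first by rewrite dot0l enorm0 mul0r.
have hu := enorm_gt0 u0; have hv := enorm_gt0 v0.
have := dotvv_ge0 (enorm v *: u - enorm u *: v).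
rewrite !(dotBl, dotBr, dotZl, dotZr) -!sqr_enorm (dotC v u) => h.
have {}h : 0 <= 2 * (enorm u * enorm v) * (enorm u * enorm v - dot u v) by lra.
by move: h; rewrite pmulr_rge0 ?subr_ge0// !mulr_gt0.
Qed.

Lemma normr_dot_le u v : `|dot u v| <= enorm u * enorm v.
Proof.
rewrite ler_norml dot_le andbT lerNl -dotNl.
by apply: le_trans (dot_le _ _) _; rewrite enormE dotNl dotNr opprK.
Qed.

Lemma enormN u : enorm (- u) = enorm u.
Proof. by rewrite enormE dotNl dotNr opprK. Qed.

Lemma enormZ k u : enorm (k *: u) = `|k| * enorm u.
Proof. by rewrite enormE dotZl dotZr mulrA -expr2 sqrtrM ?sqr_ge0// sqrtr_sqr. Qed.

Lemma ler_enorm_sqr u x : 0 <= x -> dot u u <= x ^+ 2 -> enorm u <= x.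
Proof. by move=> x0; rewrite -sqr_enorm ler_sqr ?nnegrE ?enorm_ge0. Qed.

Lemma ler_enormD u v : enorm (u + v) <= enorm u + enorm v.
Proof.
apply: ler_enorm_sqr; first by rewrite addr_ge0 ?enorm_ge0.
rewrite !(dotDl, dotDr) -!sqr_enorm (dotC v u).
by have := dot_le u v; lra.
Qed.

Lemma ler_enormB u v : enorm (u - v) <= enorm u + enorm v.
Proof. by rewrite -(enormN v) ler_enormD. Qed.

Lemma ler_enorm_sum (n : nat) (f : 'I_n -> 'rV[R]_d) :
  enorm (\sum_i f i) <= \sum_i enorm (f i).
Proof.
elim/big_ind2: _ => [|x1 x2 y1 y2 hx hy|//]; first by rewrite enorm0.
by rewrite (le_trans (ler_enormD _ _))// lerD.
Qed.

(** The mean value theorem only bounds scalar functions, hence a vector tested against a fixed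
    direction. Testing it against itself recovers its norm. *)
Lemma enorm_le_dual u c : 0 <= c -> dot u u <= c * enorm u -> enorm u <= c.
Proof.
move=> c0; rewrite -sqr_enorm expr2 => h.
have [->|u0] := eqVneq u 0; first by rewrite enorm0.
by rewrite -(ler_pM2r (enorm_gt0 u0)).
Qed.

Lemma coord_le_enorm u i : `|u 0 i| <= enorm u.
Proof.
rewrite enormE -sqrtr_sqr ler_sqrt ?dotvv_ge0// /dot (bigD1 i)//= -expr2 lerDl.
by apply: sumr_ge0 => j _; rewrite -expr2 sqr_ge0.
Qed.

End Euclid.

(** * Borel sets of row vectors and iterated integrals *)

Section BorelVectors.
Context {R : realType}.

Definition borelV (k : nat) := g_sigma_algebraType (@open 'rV[R]_k).

Lemma open_measurableV k (A : set 'rV[R]_k) :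
  open A -> measurable (A : set (borelV k)).
Proof. exact: sub_gen_smallest. Qed.

Lemma continuous_measurableV k (f : 'rV[R]_k -> R) :
  continuous f -> measurable_fun setT (f : borelV k -> R).
Proof.
move=> /continuousP cf; apply: (measurability _ (RGenOpens.measurableE R)).
by move=> _ [_ [a [b ->] <-]]; rewrite setTI; apply: open_measurableV; apply: cf; exact: interval_open.
Qed.

Lemma measurable_coord k (i : 'I_k) :
  measurable_fun setT ((fun v => v 0 i) : borelV k -> R).
Proof. by apply: continuous_measurableV => v; exact: coord_continuous. Qed.

Lemma open_bigcup_ratballs k (A : set 'rV[R]_k) : open A ->
  A = \bigcup_(p in [set p : 'rV[rat]_k * nat |
        ball (map_mx ratr p.1 : 'rV[R]_k) p.2.+1%:R^-1 `<=` A])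
      ball (map_mx ratr p.1 : 'rV[R]_k) p.2.+1%:R^-1.
Proof.
move=> oA; apply/seteqP; split=> [v Av|v [p/= pA]]; last exact: pA.
have /nbhs_ballP[e /= e0 eA] : nbhs v A by exact: open_nbhs_nbhs.
have [n ne] : exists n : nat, n.+1%:R^-1 < e / 2.
  have e2 : 0 < e / 2 by rewrite divr_gt0.
  exists (Num.truncn (e / 2)^-1).
  rewrite invf_plt ?posrE// ?invr_gt0//.
  by have /andP[] := truncn_itv (ltW (eqbRL (invr_gt0 (e/2)) e2)).
have n0 : 0 < n.+1%:R^-1 :> R by rewrite invr_gt0.
have /choice[q hq] : forall i, exists q : rat, `|ratr q - v 0 i| < n.+1%:R^-1.
  move=> i; have /rat_in_itvoo[q] : v 0 i < v 0 i + n.+1%:R^-1 by rewrite ltrDl.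
  rewrite in_itv/= => /andP[q1 q2]; exists q.
  by rewrite ger0_norm ?subr_ge0 ?(ltW q1)// ltrBlDl.
exists (\row_i q i, n) => /=; last first.
  by split=> // i j; rewrite ord1 /ball/= !mxE hq.
move=> w hw; apply: eA.
have vq : ball v n.+1%:R^-1 (map_mx ratr (\row_i q i)).
  by split=> // i j; rewrite ord1 /ball/= !mxE distrC hq.
by have := ball_triangle vq hw; apply: le_ball; rewrite (splitr e) lerD// ltW.
Qed.

Lemma measurable_ballV d (T : measurableType d) k (f : T -> borelV k) (c : 'rV[R]_k) e :
  0 < e -> (forall i, measurable_fun setT (fun t => (f t : 'rV[R]_k) 0 i)) ->
  measurable (f @^-1` ball c e).
Proof.
move=> e0 mf.
rewrite (_ : _ @^-1` _ =
  \bigcap_(i in [set: 'I_k]) ((fun t => (f t : 'rV[R]_k) 0 i) @^-1` ball (c 0 i) e)).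
  apply: fin_bigcap_measurable => // i _.
  rewrite -[X in measurable X]setTI; apply: mf => //.
  by apply: open_measurable; exact: ball_open.
apply/seteqP; split => [t [_ h] i _|t h]; first exact: h.
by split=> // i j; rewrite ord1; exact: h.
Qed.

(** The countably many balls with rational centre and radius [1 / (n + 1)] generate the open sets,
    and a max-norm ball is a finite intersection of coordinate conditions. *)
Lemma measurable_funV d (T : measurableType d) k (f : T -> borelV k) :
  (forall i, measurable_fun setT (fun t => (f t : 'rV[R]_k) 0 i)) ->
  measurable_fun setT f.
Proof.
move=> mf; apply: (@measurability _ _ T (borelV k) setT f (@open 'rV[R]_k)) => //.
move=> _ [A oA <-]; rewrite setTI (open_bigcup_ratballs oA).
rewrite preimage_bigcup bigcup_mkcond.
apply: countable_bigcupT_measurable => // p.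
case: ifP => // _; apply: measurable_ballV => //.
Qed.

Definition consV k (p : R * borelV k) : borelV k.+1 :=
  row_mx (\row_(_ < 1) p.1) (p.2 : 'rV[R]_k).

Definition unconsV k (v : borelV k.+1) : R * borelV k :=
  ((v : 'rV[R]_(1 + k)) 0 (lshift k ord0), rsubmx (v : 'rV[R]_(1 + k))).

Lemma consVK k : cancel (@consV k) (@unconsV k).
Proof.
move=> [t v]; rewrite /unconsV /consV/=; congr pair.
  by rewrite row_mxEl mxE.
by rewrite row_mxKr.
Qed.

Lemma measurable_consV k : measurable_fun setT (@consV k).
Proof.
apply: measurable_funV => i.
have [j ->|j ->] := fintype.split_ordP (i : 'I_(1 + k)).
  rewrite (_ : (fun _ => _) = fst); first exact: measurable_fst.
  apply/funext => p; apply: (etrans (row_mxEl (\row_(_ < 1) p.1) (p.2 : 'rV[R]_k) 0 j)).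
  by rewrite mxE.
rewrite (_ : (fun _ => _) = (fun v : borelV k => v 0 j) \o snd).
  apply: (measurableT_comp (measurable_coord j)); exact: measurable_snd.
apply/funext => p; exact: (row_mxEr (\row_(_ < 1) p.1) (p.2 : 'rV[R]_k) 0 j).
Qed.

Lemma measurable_unconsV k : measurable_fun setT (@unconsV k).
Proof.
apply/measurable_fun_pairP; split; first exact: measurable_coord.
apply: measurable_funV => i.
rewrite (_ : (fun _ => _) = (fun v : borelV k.+1 => v 0 (rshift 1 i))).
  exact: measurable_coord.
by apply/funext => v; rewrite /= mxE.
Qed.

End BorelVectors.

(** * Iterated integrals as integrals against a measure; translation, dilation, monotonicity *)

Section IteratedIntegral.
Context {R : realType}.
Local Open Scope ereal_scope.
Local Notation lam := (@lebesgue_measure R).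

Lemma measurable_consV_sec k (f : borelV k.+1 -> \bar R) (t : R) :
  measurable_fun setT f -> measurable_fun setT (fun v => f (consV (t, v))).
Proof.
move=> mf; apply: (measurableT_comp mf).
apply: (measurableT_comp (@measurable_consV _ k)).
exact: measurable_fun_pair.
Qed.

(** Additivity over disjoint sets requires one measure behind the nested integrals. It is the image
    under [consV] of the product of Lebesgue measure with the measure of dimension [k], by Tonelli;
    sigma-finiteness is carried along because the next product needs it. *)
Lemma iint_measure k :
  exists mu : {sigma_finite_measure set (borelV k) -> \bar R},
  forall f : borelV k -> \bar R, (forall v, 0 <= f v) -> measurable_fun setT f ->
    iint f = \int[mu]_v f v.
Proof.
elim: k => [|k [mu IH]].
  exists (dirac (0%R : borelV 0)) => f f0 mf /=.
  by rewrite integral_dirac// diracT mul1e.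
have mcons : measurable_fun setT (@consV R k) := @measurable_consV R k.
unshelve epose (nu := (pushforward (lam \x mu) (@consV R k) : {measure set (borelV k.+1) -> \bar R})).
  exact: mcons.
(* Both exhaustions are increasing, so a point that lies in [F n] and in [G m] lies in the product
   of index [maxn n m]. *)
have sf : sigma_finite setT nu.
  have /sigma_finiteP[F [TF ndF Foo]] := @sigma_finiteT _ _ _ lam.
  have /sigma_finiteP[G [TG ndG Goo]] := sigma_finiteT mu.
  exists (fun n => (@unconsV R k) @^-1` (F n `*` G n)).
    apply/seteqP; split => // v _.
    have [n _ Fn] : (\bigcup_n F n) (unconsV v).1 by rewrite -TF.
    have [m _ Gm] : (\bigcup_n G n) (unconsV v).2 by rewrite -TG.
    exists (maxn n m) => //; split.
      by move: Fn; exact/subsetPset/ndF/leq_maxl.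
    by move: Gm; exact/subsetPset/ndG/leq_maxr.
  move=> n; have [mF Fn] := Foo n; have [mG Gn] := Goo n; split.
    rewrite -[X in measurable X]setTI; apply: measurable_unconsV => //.
    exact: measurableX.
  rewrite /nu /= /pushforward -comp_preimage.
  rewrite (_ : _ \o _ = id); last by apply/funext => x; rewrite /= consVK.
  by rewrite preimage_id product_measure1E// lte_mul_pinfty// ge0_fin_numE.
pose mi := Measure_isSigmaFinite.Build _ _ _ nu sf.
pose nu' : {sigma_finite_measure set (borelV k.+1) -> \bar R} := HB.pack (Measure.sort nu) (Measure.class nu) mi.
exists nu' => f f0 mf /=.
transitivity (\int[pushforward (lam \x mu) (@consV R k)]_v f v); last by [].
rewrite ge0_integral_pushforward//.
rewrite preimage_setT fubini_tonelli1; first last.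
- by move=> x; exact: f0.
- exact: (measurableT_comp mf mcons).
apply: eq_integral => t _; rewrite IH//; exact: (measurable_consV_sec t mf).
Qed.

Lemma measurable_iint_consV k (f : borelV k.+1 -> \bar R) :
  (forall v, 0 <= f v) -> measurable_fun setT f ->
  measurable_fun setT (fun t => iint (fun v : borelV k => f (consV (t, v)))).
Proof.
move=> f0 mf; have [mu hmu] := iint_measure k.
rewrite (_ : (fun _ => _) = fubini_F mu (f \o @consV R k)).
  apply: measurable_fun_fubini_tonelli_F; last by move=> x; exact: f0.
  exact: measurableT_comp mf (@measurable_consV R k).
apply/funext => t; rewrite hmu//; exact: (measurable_consV_sec t mf).
Qed.

Lemma lebesgue_shift (c : R) (A : set R) : measurable A ->
  pushforward lam ((fun x => x + c)%R : R -> measurableTypeR R) A = lam A.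
Proof.
have ms : measurable_fun setT ((fun x => x + c)%R : R -> measurableTypeR R).
  exact: measurable_funD.
move=> mA; apply/esym/lebesgue_measure_unique => //= _ [[a b]] _ <-.
rewrite /pushforward (_ : _ @^-1` _ = `](a - c)%R, (b - c)%R]%classic).
  by rewrite !lebesgue_measure_itv/= !lte_fin ltrD2r; case: ifP => // _; congr EFin; ring.
by apply/seteqP; split => x; rewrite /= !in_itv/= ltrBlDr lerBrDr.
Qed.

Lemma integral_shift (f : R -> \bar R) c : measurable_fun setT f ->
  (forall x, 0 <= f x) -> \int[lam]_x f (x + c)%R = \int[lam]_x f x.
Proof.
move=> mf f0.
have ms : measurable_fun setT ((fun x => x + c)%R : R -> measurableTypeR R).
  exact: measurable_funD.
transitivity (\int[pushforward lam ((fun x => x + c)%R : R -> measurableTypeR R)]_x f x).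
  by rewrite ge0_integral_pushforward.
by apply: eq_measure_integral => A mA _; exact: lebesgue_shift.
Qed.

Lemma integral_dilate (f : R -> \bar R) s : (0 < s)%R -> measurable_fun setT f ->
  (forall x, 0 <= f x) -> s%:E * \int[lam]_x f (s * x)%R = \int[lam]_x f x.
Proof.
move=> s0 mf f0.
have ms : measurable_fun setT ((fun x => s * x)%R : R -> measurableTypeR R).
  exact: measurable_funM.
pose s' := NngNum (ltW s0).
pose nu := pushforward lam ((fun x => s * x)%R : R -> measurableTypeR R).
transitivity (s%:E * \int[nu]_x f x).
  by rewrite ge0_integral_pushforward.
rewrite -(@ge0_integral_mscale _ _ _ nu setT _ s')//.
apply: eq_measure_integral => A mA _; apply/esym.
apply: lebesgue_measure_unique => //= _ [[a b]] _ <-.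
rewrite /mscale /= /pushforward (_ : _ @^-1` _ = `](a / s)%R, (b / s)%R]%classic).
  rewrite !lebesgue_measure_itv/= !lte_fin ltr_pM2r ?invr_gt0//.
  by case: ifP => _; rewrite ?mule0// -EFinD -EFinM; congr EFin; field; rewrite gt_eqF.
apply/seteqP; split => x; rewrite /= !in_itv/= ltr_pdivrMr// ler_pdivlMr//;
  by rewrite [(x * s)%R]mulrC.
Qed.

Lemma iint_shift k (c : 'rV[R]_k) (f : borelV k -> \bar R) :
  (forall v, 0 <= f v) -> measurable_fun setT f ->
  iint (fun v => f (v + c)%R) = iint f.
Proof.
elim: k c f => [|k IH] c f f0 mf /=.
  by congr f; apply/rowP => -[].
pose c0 := (c : 'rV[R]_(1 + k)) 0%R (lshift k ord0).
pose c1 := rsubmx (c : 'rV[R]_(1 + k)).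
pose h t := iint (fun v : borelV k => f (consV (t, v))).
rewrite -[RHS](@integral_shift h c0)//; last 2 first.
- exact: measurable_iint_consV.
- by move=> x; have [mu hmu] := iint_measure k;
  rewrite /h hmu ?integral_ge0//; exact: (measurable_consV_sec x mf).
apply: eq_integral => t _.
rewrite /h -(IH c1 (fun v => f (consV ((t + c0)%R, v))))//; last first.
  exact: (measurable_consV_sec (t + c0)%R mf).
congr iint; apply/funext => v; congr f.
rewrite /consV /= -[c in LHS](@hsubmxK _ 1 1 k).
rewrite [LHS](@add_row_mx _ 1 1 k); congr (@row_mx R 1 1 k _ _).
by apply/rowP => i; rewrite !mxE /c0 !ord1 /=.
Qed.

Lemma iint_dilate k s (f : borelV k -> \bar R) : (0 < s)%R ->
  (forall v, 0 <= f v) -> measurable_fun setT f ->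
  (s ^+ k)%:E * iint (fun v => f (s *: v)%R) = iint f.
Proof.
move=> s0; elim: k f => [|k IH] f f0 mf /=.
  by rewrite expr0 mul1e; congr f; apply/rowP => -[].
have mf' t := measurable_consV_sec t mf.
pose h t := iint (fun v : borelV k => f (consV (t, v))).
have h0 t : 0 <= h t.
  by have [mu hmu] := iint_measure k; rewrite /h hmu ?integral_ge0//; exact: mf'.
have mh : measurable_fun setT h by exact: measurable_iint_consV.
rewrite -[RHS](integral_dilate s0 mh h0) exprS EFinM -muleA; congr (_ * _).
have sk : (0 < s ^+ k)%R by rewrite exprn_gt0.
under eq_integral => t _.
  rewrite (_ : iint _ = ((s ^+ k)^-1)%:E * h (s * t)%R); first over.
  rewrite /h -(IH (fun v => f (consV ((s * t)%R, v))))// muleA -EFinM.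
  rewrite mulVf ?gt_eqF// mul1e; congr iint; apply/funext => v; congr f.
  rewrite /consV /= [LHS](@scale_row_mx _ 1 1 k); congr (@row_mx R 1 1 k _ _).
  by apply/rowP => i; rewrite !mxE.
rewrite ge0_integralZl_EFin//.
- by rewrite muleA -EFinM divff ?gt_eqF// mul1e.
- apply: (measurableT_comp mh); exact: measurable_funM.
- by rewrite invr_ge0 ltW.
Qed.

(** The integral of a nonnegative function is a supremum over the simple functions below it, and a
    larger function has more of them; measurability does not enter. *)
Lemma le_integral_ge0 d (T : measurableType d) (mu : {measure set T -> \bar R})
    (f1 f2 : T -> \bar R) :
  (forall x, 0 <= f1 x) -> (forall x, f1 x <= f2 x) ->
  \int[mu]_x f1 x <= \int[mu]_x f2 x.
Proof.
move=> f0 f12; have f20 x : 0 <= f2 x by exact: le_trans (f12 x).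
rewrite !ge0_integralTE//; apply: ge_ereal_sup => _ [h hf <-].
apply: le_ereal_sup_tmp; eexists; last exact: lexx.
by exists h => // x; exact: le_trans (f12 x).
Qed.

Lemma iint_ge0 k (f : 'rV[R]_k -> \bar R) : (forall v, 0 <= f v) -> 0 <= iint f.
Proof.
by elim: k f => [|k IH] f f0 //=; apply: integral_ge0 => t _; exact: IH.
Qed.

Lemma le_iint k (f1 f2 : 'rV[R]_k -> \bar R) :
  (forall v, 0 <= f1 v) -> (forall v, f1 v <= f2 v) -> iint f1 <= iint f2.
Proof.
elim: k f1 f2 => [|k IH] f1 f2 f0 f12 //=.
by apply: le_integral_ge0 => t; [exact: iint_ge0|exact: IH].
Qed.

End IteratedIntegral.

(** * Volume of balls and of thin sets *)

Section BallVolume.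
Context {R : realType}.
Local Open Scope ereal_scope.

Lemma le_indic T (A B : set T) x : A `<=` B -> (\1_A x <= \1_B x :> R)%R.
Proof.
move=> AB; rewrite !indicE ler_nat; have [xA|//] := boolP (x \in A).
by rewrite mem_set//; apply: AB; exact: set_mem.
Qed.

Lemma eq_indic T T' (A : set T) (B : set T') x y :
  (A x <-> B y) -> \1_A x = \1_B y :> R.
Proof.
by move=> AB; rewrite !indicE; congr (_ %:R); congr nat_of_bool; exact: asbool_equiv_eq.
Qed.

Lemma enorm_continuous k : continuous (@enorm R k).
Proof.
have csq : continuous (fun v : 'rV[R]_k => \sum_(i < k) v 0 i ^+ 2)%R.
  apply: (@continuous_big R 'I_k +%R 0%R xpredT (@add_continuous R^o)) => i _ v.
  apply: (@continuous_comp _ _ _ _ (fun x : R => (x ^+ 2)%R)).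
    exact: coord_continuous.
  exact: exprn_continuous.
move=> v; apply: (@continuous_comp _ _ _ _ (@Num.sqrt R)); first exact: csq.
exact: sqrt_continuous.
Qed.

Lemma measurable_cballV k (c : 'rV[R]_k) rad :
  measurable (cball c rad : set (borelV k)).
Proof.
rewrite (_ : cball c rad =
  ((fun x : 'rV[R]_k => enorm (x - c)) : borelV k -> R) @^-1` `]-oo, rad]).
  rewrite -[X in measurable X]setTI; apply: continuous_measurableV => //.
  move=> x; apply: (@continuous_comp _ _ _ (fun x : 'rV[R]_k => x - c)%R (@enorm R k)).
    by apply: (@continuousB _ _ _ id (fun=> c)); [move=> ?; exact: cvg_id|exact: cst_continuous].
  exact: enorm_continuous.
by apply/seteqP; split => x; rewrite /= in_itv.
Qed.

Lemma iint0 k : iint (fun _ : 'rV[R]_k => 0) = 0.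
Proof.
elim: k => [//|k IH] /=.
by under eq_integral do rewrite IH; rewrite integral0.
Qed.

Definition box k (c : R) : set 'rV[R]_k := [set v | forall i, `|v 0%R i| <= c]%R.

Lemma iint_box k (c : R) : (0 <= c)%R ->
  iint (fun v : 'rV[R]_k => (\1_(@box k c) v)%:E) = ((2 * c) ^+ k)%:E.
Proof.
move=> c0; elim: k => [|k IH] /=.
  by rewrite expr0 indicE mem_set// => -[].
have boxE (t : R) (v : 'rV[R]_k) :
    @box k.+1 c (row_mx (\row_(_ < 1) t) v) <-> (`|t| <= c)%R /\ @box k c v.
  split=> [h|[tc h] i].
    split=> [|i].
      by have := h (lshift k (ord0 : 'I_1)); rewrite (row_mxEl (\row_(_ < 1) t) v) mxE.
    by have := h (rshift 1 i); rewrite (row_mxEr (\row_(_ < 1) t) v).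
  have [j ->|j ->] := fintype.split_ordP (i : 'I_(1 + k)).
    by rewrite (row_mxEl (\row_(_ < 1) t) v) mxE.
  by rewrite (row_mxEr (\row_(_ < 1) t) v).
under eq_integral => t _.
  rewrite (_ : iint _ = ((2 * c) ^+ k)%:E * (\1_`[(- c)%R, c] t)%:E); first over.
  have [tc|tc] := boolP (`|t| <= c)%R.
    rewrite [X in _ * (X%:E)]indicE mem_set; last by rewrite /= in_itv/= -ler_norml.
    rewrite mule1 -IH; congr iint; apply/funext => v; congr EFin.
    by apply: eq_indic; rewrite boxE; split=> [[]|].
  rewrite [X in _ * (X%:E)]indicE memNset; last first.
    by rewrite /= in_itv/= -ler_norml; exact/negP.
  rewrite mule0 -(iint0 k); congr iint; apply/funext => v.
  by rewrite indicE memNset// boxE => -[] /(negP tc).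
rewrite ge0_integralZl_EFin//; last by rewrite exprn_ge0// mulr_ge0.
rewrite integral_indic// setIT /= lebesgue_measure_itv/= lte_fin.
have [cc|cc] := ltP (- c)%R c; first by rewrite -EFinD -EFinM exprS; congr EFin; ring.
have -> : c = 0%R by lra.
by rewrite mule0 mulr0 expr0n.
by apply/measurable_EFinP; exact: measurable_indic.
Qed.

(** The ball lies between two cubes, whose volumes are explicit. The inner half-side is
    [rad / (k + 1)] rather than [rad / sqrt k], which also makes sense for [k = 0]. *)
Lemma ball_volume k rad : (0 < rad)%R ->
  exists2 V : R, (0 < V)%R & iint (fun v : 'rV[R]_k => (\1_(cball 0 rad) v)%:E) = V%:E.
Proof.
move=> r0; set I := iint _.
have I1 : I <= ((2 * rad) ^+ k)%:E.
  rewrite -(iint_box _ (ltW r0)) /I; apply: le_iint => v; first by rewrite lee_fin.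
  rewrite lee_fin; apply: le_indic => /= w; rewrite /cball/= subr0 => h i.
  exact: le_trans (coord_le_enorm w i) h.
have I2 : ((2 * (rad / k.+1%:R)) ^+ k)%:E <= I.
  have rk : (0 <= rad / k.+1%:R)%R by rewrite divr_ge0// ltW.
  rewrite -iint_box//; rewrite /I; apply: le_iint => v; first by rewrite lee_fin.
  rewrite lee_fin; apply: le_indic => /= w; rewrite /cball/= subr0 => h.
  apply: ler_enorm_sqr; first exact: ltW.
  apply: (@le_trans _ _ (\sum_(i < k) (rad / k.+1%:R) ^+ 2)%R).
    by apply: ler_sum => i _; rewrite -expr2 -real_normK ?num_real// ler_sqr ?nnegrE.
  rewrite sumr_const card_ord -[X in (X <= _)%R]mulr_natr exprMn -[X in (X <= _)%R]mulrA.
  rewrite -[X in (_ <= X)%R]mulr1; apply: ler_wpM2l; first exact: sqr_ge0.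
  rewrite exprVn mulrC ler_pdivrMr ?exprn_gt0// mul1r.
  by rewrite -natrX ler_nat (leq_trans (leqnSn k))// expnS leq_pmulr// expn_gt0.
have Ifin : I \is a fin_num.
  rewrite ge0_fin_numE; first exact: le_lt_trans I1 (ltry _).
  by apply: le_trans I2; rewrite lee_fin exprn_ge0// mulr_ge0// divr_ge0// ltW.
exists (fine I); last by rewrite fineK.
rewrite -lte_fin fineK//; apply: lt_le_trans I2.
by rewrite lte_fin exprn_gt0// mulr_gt0// divr_gt0.
Qed.

Lemma ball_volume_dilate k rad s : (0 < s)%R ->
  iint (fun v : 'rV[R]_k => (\1_(cball 0 (s * rad)%R) v)%:E) =
  (s ^+ k)%:E * iint (fun v : 'rV[R]_k => (\1_(cball 0 rad) v)%:E).
Proof.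
move=> s0; rewrite -(@iint_dilate _ _ s)//; last first.
  apply/measurable_EFinP; apply: measurable_indic; exact: measurable_cballV.
congr (_ * _); congr iint; apply/funext => v; congr EFin.
by apply: eq_indic; rewrite /cball/= !subr0 enormZ gtr0_norm// ler_pM2l.
Qed.

End BallVolume.

Section ThinSets.
Context {R : realType} {k : nat}.
Implicit Types (Y X : set (borelV (R:=R) k)) (u v : 'rV[R]_k) (rad w : R).

Lemma measurable_shiftV (c : 'rV[R]_k) :
  measurable_fun setT ((fun v => v + c) : borelV k -> borelV k).
Proof.
apply: measurable_funV => i.
rewrite (_ : (fun _ => _) = (fun v : borelV k => v 0 i + c 0 i)); last first.
  by apply/funext => v; rewrite mxE.
by apply: measurable_funD => //; exact: measurable_coord.
Qed.

Lemma measurable_dotV v : measurable_fun setT ((fun u => dot u v) : borelV k -> R).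
Proof.
apply: (@measurable_sum _ _ _ _ 'I_k _ (fun i (u : borelV k) => u 0 i * v 0 i)) => i.
by apply: measurable_funM => //; exact: measurable_coord.
Qed.

(** The power is at most [exp (1 / 2)], and [exp (- 1 / 2) >= 1 - 1 / 2]. *)
Lemma expn_slightly_gt1 : (0 < k)%N -> (1 + (2 * k%:R)^-1) ^+ k <= 2 :> R.
Proof.
move=> k0; have k0' : 0 < k%:R :> R by rewrite ltr0n.
apply: (@le_trans _ _ (expR (2 * k%:R)^-1 ^+ k)).
  apply: lerXn2r; rewrite ?nnegrE ?expR_ge0 ?expR_ge1Dx//.
rewrite -expRM_natl -[X in _ <= X]invrK -[expR _]invrK -expRN.
rewrite lef_pV2 ?posrE ?expR_gt0//.
apply: le_trans (expR_ge1Dx _).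
by rewrite (_ : k%:R * _ = 2^-1); [lra|field; rewrite gt_eqF].
Qed.

Local Notation vol A := (iint (fun u : 'rV[R]_k => (\1_A u)%:E)).

(* On the half space [dot u v <= 0], translating by [h v] with [h <= rad / sqrt k]
   increases the norm at most to [rad * (1 + 1 / (2 k))]. Hence the translates of
   [Y] by multiples of [w v], which are disjoint, all fit in a ball of at most
   twice the volume. *)
Lemma half_thin_volume Y v rad w : (0 < k)%N -> 0 < rad -> 0 < w ->
  measurable Y -> enorm v = 1 ->
  (forall u, Y u -> enorm u <= rad /\ dot u v <= 0) ->
  (forall u u' s, Y u -> Y u' -> u = u' + s *: v -> `|s| < w) ->
  (vol Y <= (2 * (w * Num.sqrt k%:R / rad))%:E * vol (cball 0 rad))%E.
Proof.
move=> k0 r0 w0 mY v1 Yball Ygap.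
have k0' : 0 < k%:R :> R by rewrite ltr0n.
have sk0 : 0 < Num.sqrt k%:R :> R by rewrite sqrtr_gt0.
have [mu hmu] := @iint_measure R k.
have volE (A : set (borelV k)) : measurable A -> vol A = mu A.
  move=> mA; rewrite hmu//; last first.
    by apply/measurable_EFinP; exact: measurable_indic.
  by rewrite integral_indic// setIT.
pose h := rad / Num.sqrt k%:R.
have h0 : 0 < h by rewrite divr_gt0.
(* The translates are numbered from 0 to the integer part of [h / w]: each shift [j w] stays at most
   [h], while their number exceeds [h / w]. *)
pose n := (Num.truncn (h / w)).+1.
have /andP[hn1 hn2] : (Num.truncn (h / w))%:R <= h / w < n%:R.
  by apply: truncn_itv; rewrite divr_ge0// ltW.
pose Z (j : nat) : set (borelV k) := (fun u : borelV k => (u - (j%:R * w) *: v : borelV k)) @^-1` Y.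
have mZ j : measurable (Z j).
  rewrite -[X in measurable X]setTI; exact: measurable_shiftV.
have volZ j : mu (Z j) = vol Y.
  rewrite -volE// -(@iint_shift _ _ (- ((j%:R * w) *: v)) (fun u => (\1_Y u)%:E))//.
  by apply/measurable_EFinP; exact: measurable_indic.
(* A common point of [Z i] and [Z j] yields two points of [Y] that differ by [(j - i) w v], against
   the gap hypothesis unless [i = j]. *)
have tZ : trivIset setT Z.
  apply/trivIsetP => i j _ _ ij; apply/seteqP; split=> // u [/= Yi Yj].
  have := Ygap _ _ ((j%:R - i%:R) * w) Yi Yj.
  rewrite (_ : _ + _ *: v = u - (i%:R * w) *: v); last first.
    by rewrite mulrBl scalerBl addrA subrK.
  move=> /(_ erefl); rewrite normrM (gtr0_norm w0) gtr_pMl//.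
  rewrite ltr_norml => /andP[h1 h2].
  case: (ltngtP i j) ij => // ij _.
    have : (i.+1)%:R <= j%:R :> R by rewrite ler_nat.
    by rewrite -natr1; lra.
  have : (j.+1)%:R <= i%:R :> R by rewrite ler_nat.
  by rewrite -natr1; lra.
have mUZ : measurable (\big[setU/set0]_(j < n) Z j) by exact: bigsetU_measurable.
have [V V0 VE] := @ball_volume R k rad r0.
have Yle : (vol Y <= V%:E)%E.
  rewrite -VE; apply: le_iint => u; rewrite lee_fin//; apply: le_indic => z Yz.
  by rewrite /cball/= subr0; have [] := Yball _ Yz.
have Yfin : vol Y \is a fin_num.
  rewrite ge0_fin_numE; first exact: le_lt_trans Yle (ltry _).
  by apply: iint_ge0 => u; rewrite lee_fin.
have nY : (n%:R * fine (vol Y))%:E = mu (\big[setU/set0]_(j < n) Z j).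
  rewrite measure_semi_additive_ord_I//; last exact: sub_trivIset tZ.
  rewrite (eq_bigr (fun _ => (fine (vol Y))%:E)); last first.
    by move=> i _; rewrite fineK//; exact: volZ.
  by rewrite sumEFin sumr_const card_ord mulr_natl.
have UZball : (mu (\big[setU/set0]_(j < n) Z j) <= 2%:E * vol (cball 0 rad))%E.
  apply: (@le_trans _ _ (vol (cball 0 ((1 + (2 * k%:R)^-1) * rad)))); last first.
    rewrite ball_volume_dilate; last by rewrite ltr_pwDl// invr_ge0 mulr_ge0.
    apply: lee_pmul => //.
    - by apply: iint_ge0 => u; rewrite lee_fin.
    - by rewrite lee_fin expn_slightly_gt1.
  rewrite volE; last exact: measurable_cballV.
  apply: le_measure; rewrite ?inE//; first exact: measurable_cballV.
  rewrite -bigcup_mkord => u [j /= jn Yu].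
  have [yr yv] := Yball _ Yu.
  have jh : j%:R * w <= h.
    rewrite -ler_pdivlMr//; apply: le_trans hn1.
    by rewrite ler_nat.
  set s := j%:R * w in Yu yr yv jh.
  have s0 : 0 <= s by rewrite mulr_ge0// ltW.
  rewrite /cball/= subr0 -(subrK (s *: v) u).
  move: (u - s *: v) yr yv => y yr yv.
  apply: ler_enorm_sqr.
    by rewrite mulr_ge0 ?ltW// ltr_pwDl// invr_ge0 mulr_ge0.
  rewrite !(dotDl, dotDr, dotZl, dotZr) -!sqr_enorm v1 (dotC v y).
  have h2 : h ^+ 2 = rad ^+ 2 / k%:R by rewrite expr_div_n sqr_sqrtr// ltW.
  have : enorm y ^+ 2 <= rad ^+ 2 by rewrite ler_sqr ?nnegrE ?enorm_ge0// ltW.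
  have : s ^+ 2 <= rad ^+ 2 / k%:R.
    by rewrite -h2 ler_sqr ?nnegrE// ltW.
  have : s * dot y v <= 0 by rewrite mulr_ge0_le0.
  have -> : ((1 + (2 * k%:R)^-1) * rad) ^+ 2 =
      rad ^+ 2 + rad ^+ 2 / k%:R + (rad * (2 * k%:R)^-1) ^+ 2.
    by field; rewrite gt_eqF.
  have := sqr_ge0 (rad * (2 * k%:R)^-1); rewrite expr1n.
  by lra.
move: UZball; rewrite -nY VE -{2}(fineK Yfin) -!EFinM !lee_fin => {}nY.
rewrite -(ler_pM2l (_ : 0 < n%:R)) ?ltr0n//.
apply: le_trans nY _.
have -> : n%:R * (2 * (w * Num.sqrt k%:R / rad) * V) = 2 * V * (n%:R * (h / w)^-1).
  by rewrite /h; field; rewrite ?gt_eqF.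
rewrite ler_peMr ?mulr_ge0 ?(ltW V0)//.
by rewrite ler_pdivlMr ?divr_gt0// mul1r ltW.
Qed.

(** The half-space bound is applied to the part of [X] where [dot u v <= 0] with direction [v], and
    to the rest with direction [- v]; the two factors 2 add up to 4. *)
Lemma thin_volume X v rad w : (0 < k)%N -> 0 < rad -> 0 < w ->
  measurable X -> X `<=` cball 0 rad -> enorm v = 1 ->
  (forall u u' s, X u -> X u' -> u = u' + s *: v -> `|s| < w) ->
  (vol X <= (4 * (w * Num.sqrt k%:R / rad))%:E * vol (cball 0 rad))%E.
Proof.
move=> k0 r0 w0 mX Xball v1 Xgap.
have [mu hmu] := @iint_measure R k.
have volE (A : set (borelV k)) : measurable A -> vol A = mu A.
  move=> mA; rewrite hmu//; last first.
    by apply/measurable_EFinP; exact: measurable_indic.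
  by rewrite integral_indic// setIT.
have half (v' : 'rV[R]_k) : measurable [set u : borelV k | dot u v' <= 0].
  rewrite (_ : [set _ | _] = (fun u : borelV k => dot u v') @^-1` `]-oo, 0]).
    by rewrite -[X in measurable X]setTI; exact: measurable_dotV.
  by apply/seteqP; split => u; rewrite /= in_itv.
pose H v' : set (borelV k) := X `&` [set u : borelV k | dot u v' <= 0].
have mH v' : measurable (H v') by apply: measurableI.
have HX : X = H v `|` H (- v).
  apply/seteqP; split=> [u Xu|u [[]|[]]//].
  by have [uv|uv] := leP (dot u v) 0; [left|right]; split=> //=;
    rewrite dotNr oppr_le0 ltW.
have bH v' : enorm v' = 1 -> (forall u u' s, X u -> X u' -> u = u' + s *: v' -> `|s| < w) ->
    (vol (H v') <= (2 * (w * Num.sqrt k%:R / rad))%:E * vol (cball 0 rad))%E.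
  move=> v'1 gap; apply: (@half_thin_volume (H v') v' rad w) => //.
    by move=> u [Xu uv]; split=> //; have := Xball _ Xu; rewrite /cball/= subr0.
  by move=> u u' s [Xu _] [Xu' _]; exact: gap.
rewrite volE// {1}HX; 
apply: (@le_trans _ _ (mu (H v) + mu (H (- v)%R))%E).
  by apply: measureU2; exact: mH.
rewrite -!volE//; have [V V0 VE] := @ball_volume R k rad r0; rewrite VE in bH *.
apply: le_trans (leeD (bH v _ _) (bH (- v) _ _)) _ => //.
- by rewrite enormN.
- move=> u u' s Xu Xu'; rewrite scalerN -scaleNr => e.
  by rewrite -normrN; exact: Xgap e.
- by rewrite -!EFinM -EFinD lee_fin; lra.
Qed.

End ThinSets.

(** * Averages over the ball *)

Section UniformBall.
Context {R : realType} {d : nat}.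
Implicit Types (rad c p : R) (h : 'rV[R]_d -> \bar R) (w : nat -> 'rV[R]_d).
Local Notation vol A := (iint (fun u : 'rV[R]_d => (\1_A u)%:E)).

Lemma unif_ball_avg_ge0 rad h : (forall u, 0 <= h u)%E ->
  (0 <= unif_ball_avg rad h)%E.
Proof.
move=> h0; apply: mule_ge0.
  by rewrite lee_fin invr_ge0 fine_ge0//; apply: iint_ge0 => u; rewrite lee_fin.
by apply: iint_ge0 => u; apply: mule_ge0 => //; rewrite lee_fin.
Qed.

(** As [h] may fail to be measurable, it is minorized on the ball by [c] times the indicator of the
    ball minus [X], whose integral can be computed. *)
Lemma unif_ball_avg_ge rad c p (X : set (borelV d)) h :
  0 < rad -> measurable X -> X `<=` cball 0 rad ->
  (vol X <= p%:E * vol (cball 0 rad))%E -> 0 <= c -> (forall u, 0 <= h u)%E ->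
  (forall u, cball 0 rad u -> ~ X u -> (c%:E <= h u)%E) ->
  ((c * (1 - p))%:E <= unif_ball_avg rad h)%E.
Proof.
move=> r0 mX XB volX c0 h0 hX; rewrite /unif_ball_avg.
have [V V0 VE] := @ball_volume R d rad r0; rewrite VE in volX *.
have [mu hmu] := @iint_measure R d.
have volE (A : set (borelV d)) : measurable A -> vol A = mu A.
  move=> mA; rewrite hmu//; last first.
    by apply/measurable_EFinP; exact: measurable_indic.
  by rewrite integral_indic// setIT.
set B := cball 0 rad; have mB : measurable (B : set (borelV d)) by exact: measurable_cballV.
have mBX : measurable (B `\` X : set (borelV d)) by exact: measurableD.
have XE : (B `&` X : set (borelV d)) = X by apply/setIidPr.
have Bsplit : (vol B = vol (B `\` X) + vol X)%E.
  by rewrite !volE// -[in X in (_ = _ + X)%E]XE; exact: measureDI.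
have Yle : (c%:E * vol (B `\` X) <= iint (fun v => (\1_B v)%:E * h v))%E.
  rewrite hmu//; last by apply/measurable_EFinP; exact: measurable_indic.
  rewrite -ge0_integralZl_EFin//; last first.
    by apply/measurable_EFinP; exact: measurable_indic.
  rewrite -hmu; first last.
  - apply: measurable_funeM; apply/measurable_EFinP; exact: measurable_indic.
  - by move=> u; rewrite mule_ge0// lee_fin.
  apply: le_iint => u; first by rewrite mule_ge0// lee_fin.
  have [[Bu Xu]|nBX] := pselect ((B `\` X) u).
    by rewrite !indicE !mem_set// mule1 mul1e; exact: hX.
  rewrite [X in (_ * X%:E <= _)%E]indicE memNset// mule0.
  by rewrite mule_ge0// lee_fin.
have Xfin : vol X \is a fin_num.
  rewrite ge0_fin_numE; first exact: le_lt_trans volX (ltry _).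
  by apply: iint_ge0 => u; rewrite lee_fin.
move: volX Bsplit Yle; rewrite -(fineK Xfin) VE => volX Bsplit Yle.
have Yfin : vol (B `\` X) \is a fin_num.
  by move: Bsplit; case: (vol (B `\` X)).
move: Bsplit Yle; rewrite -(fineK Yfin) -EFinD => -[Bsplit] Yle.
move: volX; rewrite -EFinM lee_fin => volX.
apply: le_trans (lee_wpmul2l _ Yle); last by rewrite lee_fin invr_ge0 ltW.
rewrite /= -!EFinM lee_fin ler_pdivlMl// mulrCA ler_wpM2l//.
by rewrite Bsplit in volX *; lra.
Qed.

(* Integrals of nonmeasurable nonnegative functions are lower integrals, which are
   still monotone; conditioning on the past [w i], [i < t], therefore requires only
   the measurability of each section [bad t w]. *)
Lemma unif_ball_seq_exp_ge rad k (bad : nat -> (nat -> 'rV[R]_d) -> set (borelV d))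
    (p : nat -> R) (F : (nat -> 'rV[R]_d) -> \bar R) c :
  0 < rad -> (forall t, 0 <= p t <= 1) ->
  (forall t w, measurable (bad t w)) ->
  (forall t w, bad t w `<=` cball 0 rad) ->
  (forall t w, vol (bad t w) <= (p t)%:E * vol (cball 0 rad))%E ->
  (forall t w w', (forall i, (i < t)%N -> w i = w' i) -> bad t w = bad t w') ->
  0 <= c -> (forall w, 0 <= F w)%E ->
  (forall w, (forall t, (t < k)%N -> cball 0 rad (w t) /\ ~ bad t w (w t)) ->
    (c%:E <= F w)%E) ->
  ((c * \prod_(t < k) (1 - p t))%:E <= unif_ball_seq_exp rad k F)%E.
Proof.
move=> r0 p01 mbad bbad vbad past.
elim: k F c => [|k IH] F c c0 F0 hF /=.
  by rewrite big_ord0 mulr1; apply: hF.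
have q0 t : 0 <= 1 - p t by rewrite subr_ge0; have /andP[] := p01 t.
(* The draw of index [k] is averaged innermost: that average is at least [c * (1 - p k)] along good
   pasts, and this product is the constant given to the induction hypothesis. *)
rewrite big_ord_recr/= mulrCA mulrC; apply: IH.
- by rewrite mulr_ge0.
- by move=> w; apply: unif_ball_avg_ge0.
move=> w good; apply: (@unif_ball_avg_ge rad c (p k) (bad k w)) => //.
move=> u Bu nbad; apply: hF => t; rewrite ltnS leq_eqVlt => /orP[/eqP ->|tk].
  rewrite eqxx; split=> //; rewrite (past k _ w)// => i ik.
  by rewrite ltn_eqF.
rewrite ltn_eqF//; have [Bt nb] := good t tk; split=> //.
by rewrite (past t _ w)// => i it; rewrite ltn_eqF// (ltn_trans it).
Qed.

End UniformBall.

(** * Gradients and Hessians along segments *)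

Section LineCalculus.
Context {R : realType} {d : nat}.
Implicit Types (x y u v e : 'rV[R]_d) (g : 'rV[R]_d -> R^o).

Lemma is_derive_line (W : normedModType R) (f : 'rV[R]_d -> W) x v (t : R) :
  derivable f (x + t *: v) v ->
  is_derive t (1 : R) (fun s : R => f (x + s *: v)) ('D_v f (x + t *: v)).
Proof.
move=> df; have E : (fun h : R => h^-1 *:
    (((fun s : R => f (x + s *: v)) \o shift t) (h *: (1 : R)) - f (x + t *: v))) =
    (fun h : R => h^-1 *: ((f \o shift (x + t *: v)) (h *: v) - f (x + t *: v))).
  apply/funext => h /=; rewrite /shift; congr (_ *: (f _ - _)).
  transitivity (x + (h + t) *: v); last by rewrite scalerDl addrCA.
  by congr (_ + _ *: v); congr (_ + t); exact: mulr1.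
split; first by rewrite /derivable E.
by rewrite /derive E.
Qed.

Lemma derive_coordE (W : normedModType R) (f : 'rV[R]_d -> W) x v :
  differentiable f x -> 'D_v f x = \sum_i v 0 i *: 'D_(e_ R i) f x.
Proof.
move=> df; rewrite deriveE// {1}(row_sum_delta v) linear_sum/=.
by apply: eq_bigr => i _; rewrite linearZ/= deriveE.
Qed.

Lemma line_grad g x v (t : R) : (forall y, differentiable g y) ->
  is_derive t (1 : R) (fun s : R => g (x + s *: v)) (dot (grad g (x + t *: v)) v).
Proof.
move=> dg.
have -> : dot (grad g (x + t *: v)) v = 'D_v g (x + t *: v).
  rewrite derive_coordE//; apply: eq_bigr => i _.
  by rewrite mxE mulrC.
by apply: is_derive_line; exact: diff_derivable.
Qed.

Definition hessv g x v : 'rV[R]_d := (hess g x *m v^T)^T.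

Lemma derive_gradE g x v : differentiable (grad g) x -> 'D_v (grad g) x = hessv g x v.
Proof.
move=> dg; rewrite derive_coordE//; apply/rowP => i.
rewrite summxE !mxE; apply: eq_bigr => j _.
by rewrite !mxE mulrC.
Qed.

Lemma line_hess g x v e (t : R) : differentiable (grad g) (x + t *: v) ->
  is_derive t (1 : R) (fun s : R => dot (grad g (x + s *: v)) e)
    (dot (hessv g (x + t *: v) v) e).
Proof.
move=> dg; rewrite -derive_gradE//.
have dl : is_derive t (1 : R) (fun s : R => grad g (x + s *: v)) ('D_v (grad g) (x + t *: v)).
  by apply: is_derive_line; exact: diff_derivable.
have [dc <-] := dl.
have dci i : derivable (fun s : R => (grad g (x + s *: v)) 0 i) t 1.
  by move/derivable_mxP : dc.
pose ph i : R -> R^o := fun s : R => (grad g (x + s *: v)) 0 i.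
have dph i : is_derive t (1 : R) (ph i) ('D_1 (ph i) t) by apply: derivableP; exact: dci.
have -> : (fun s : R => dot (grad g (x + s *: v)) e) = \sum_(i < d) (e 0 i *: ph i).
  apply/funext => s; rewrite /dot fct_sumE; apply: eq_bigr => i _.
  by rewrite /= mulrC.
rewrite derive_mx// /dot.
rewrite (eq_bigr (fun i => e 0 i *: ('D_1 (ph i) t))); last first.
  by move=> i _; rewrite mxE mulrC.
by apply: is_derive_sum => i.
Qed.

(* The derivative of the segment functional is Lipschitz, so comparing it with
   its tangent parabola recovers the factor 1/2. *)
Lemma descent_lemma g (L : R) x v : (forall y, differentiable g y) ->
  (forall y z, enorm (grad g y - grad g z) <= L * enorm (y - z)) ->
  g (x + v) <= g x + dot (grad g x) v + L / 2 * enorm v ^+ 2.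
Proof.
move=> dg lip.
pose psi (t : R) := g (x + t *: v) - (t * dot (grad g x) v + L / 2 * enorm v ^+ 2 * t ^+ 2).
pose dpsi (t : R) := dot (grad g (x + t *: v)) v - (dot (grad g x) v + L * enorm v ^+ 2 * t).
have der t : is_derive t (1 : R) (psi : R -> R^o) (dpsi t).
  have h1 := line_grad x v t dg.
  apply: is_derive_eq.
  rewrite /dpsi; congr (_ - _).
  have E (p q : R) : t * 0 + p * 1 + L / 2 * q * (t * 1 + t * 1) = p + L * q * t by field.
  exact: E.
have [c] : exists2 c, c \in `](0:R), 1[%R & psi 1 - psi 0 = dpsi c * (1 - 0).
  apply: (@MVT R psi dpsi) => //.
  apply: (@derivable_within_continuous R R^o) => t _; by have [] := der t.
rewrite in_itv/= => /andP[c0 c1]; rewrite subr0 mulr1 => E.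
have : dpsi c <= 0.
  have : dot (grad g (x + c *: v) - grad g x) v <= L * enorm v ^+ 2 * c.
    apply: le_trans (dot_le _ _) _.
    have := lip (x + c *: v) x; rewrite addrAC subrr add0r enormZ gtr0_norm// => h.
    by apply: le_trans (ler_wpM2r (enorm_ge0 v) h) _; rewrite expr2; lra.
  by rewrite /dpsi dotBl; lra.
rewrite -E /psi scale1r scale0r addr0 mul0r expr0n/= mul1r expr1n; lra.
Qed.

(** Mean value theorem for the gradient along the segment from [v] to [u], tested against [e]; the
    segment stays within [rho] of [xb] by convexity of the ball. *)
Lemma hess_increment g (L rho : R) x xb u v e :
  (forall y, enorm (y - xb) <= rho -> differentiable (grad g) y) ->
  (forall y w, enorm (y - xb) <= rho -> dot (hessv g y w - hessv g xb w) e <= L * enorm w * enorm e) ->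
  enorm (u - xb) <= rho -> enorm (v - xb) <= rho ->
  dot (grad g u - grad g v - hessv g xb (u - v)) e <= L * enorm (u - v) * enorm e.
Proof.
move=> dg hL hu hv.
pose phi (t : R) := dot (grad g (v + t *: (u - v))) e.
have seg (t : R) : 0 <= t <= 1 -> enorm (v + t *: (u - v) - xb) <= rho.
  move=> /andP[t0 t1].
  have -> : v + t *: (u - v) - xb = t *: (u - xb) + (1 - t) *: (v - xb).
    by apply/rowP => i; rewrite !mxE; ring.
  apply: le_trans (ler_enormD _ _) _; rewrite !enormZ !ger0_norm ?subr_ge0//.
  have := ler_wpM2l t0 hu; have := ler_wpM2l (_ : 0 <= 1 - t) hv.
  by rewrite subr_ge0 => /(_ t1); lra.
have der (t : R) : 0 <= t <= 1 -> is_derive t (1 : R) (phi : R -> R^o)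
    (dot (hessv g (v + t *: (u - v)) (u - v)) e).
  by move=> t01; apply: line_hess; apply: dg; exact: seg.
have [c] : exists2 c, c \in `](0:R), 1[%R & phi 1 - phi 0 =
    dot (hessv g (v + c *: (u - v)) (u - v)) e * (1 - 0).
  apply: (@MVT R phi (fun t => dot (hessv g (v + t *: (u - v)) (u - v)) e)) => //.
    move=> t; rewrite in_itv/= => /andP[t0 t1]; apply: der.
    by rewrite !ltW.
  apply: (@derivable_within_continuous R R^o) => t; rewrite in_itv/= => t01.
  by have [] := der t t01.
rewrite in_itv/= => /andP[c0 c1]; rewrite subr0 mulr1 /phi scale1r scale0r addr0 [v + (u - v)]addrC subrK => E.
have c01 : 0 <= c <= 1 by rewrite !ltW.
by rewrite 2!dotBl E -dotBl; apply: hL; exact: seg.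
Qed.

(** One mean value step in the direction [u] turns the second difference into [h] times a gradient
    increment over [h *: v], tested against [u]. Linearizing that increment at [x] costs the
    Lipschitz constant times a radius of order [h], hence an error of order [h ^ 3]. *)
Lemma second_difference g (L rho h : R) x u v :
  (forall y, differentiable g y) ->
  (forall y, enorm (y - x) <= rho -> differentiable (grad g) y) -> 0 <= L ->
  (forall y w e, enorm (y - x) <= rho ->
    dot (hessv g y w - hessv g x w) e <= L * enorm (y - x) * enorm w * enorm e) ->
  0 < h -> h * (enorm u + enorm v) <= rho ->
  `|g (x + h *: v + h *: u) - g (x + h *: u) - g (x + h *: v) + g x
     - h ^+ 2 * dot (hessv g x v) u|
  <= h ^+ 3 * (L * (enorm u + enorm v) * enorm v * enorm u).
Proof.
move=> dg dgg L0 hL h0 hrho.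
pose phi (s : R) := g (x + h *: v + s *: u) - g (x + s *: u).
pose dphi (s : R) := dot (grad g (x + h *: v + s *: u)) u - dot (grad g (x + s *: u)) u.
have der s : is_derive s (1 : R) (phi : R -> R^o) (dphi s).
  have h1 := line_grad (x + h *: v) u s dg; have h2 := line_grad x u s dg.
  exact: is_deriveB.
have [c] : exists2 c, c \in `](0:R), h[%R & phi h - phi 0 = dphi c * (h - 0).
  apply: (@MVT R phi dphi) => //.
  by apply: (@derivable_within_continuous R R^o) => s _; have [] := der s.
rewrite in_itv/= => /andP[c0 ch]; rewrite subr0 /phi scale0r !addr0 => E.
have -> : g (x + h *: v + h *: u) - g (x + h *: u) - g (x + h *: v) + g x =
    g (x + h *: v + h *: u) - g (x + h *: u) - (g (x + h *: v) - g x) by ring.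
rewrite E.
set p := x + h *: v + c *: u; set q := x + c *: u.
have [rho' rho'E] : exists r, r = h * (enorm u + enorm v) by exists (h * (enorm u + enorm v)).
rewrite -rho'E in hrho.
have pE : p - q = h *: v.
  by apply/rowP => i; rewrite /p /q !mxE; ring.
have qr : enorm (q - x) <= rho'.
  rewrite /q addrAC subrr add0r enormZ gtr0_norm// rho'E.
  have := ler_wpM2r (enorm_ge0 u) (ltW ch).
  by have := mulr_ge0 (ltW h0) (enorm_ge0 v); lra.
have pr : enorm (p - x) <= rho'.
  have -> : p - x = h *: v + c *: u by apply/rowP => i; rewrite /p !mxE; ring.
  apply: le_trans (ler_enormD _ _) _; rewrite !enormZ !gtr0_norm// rho'E.
  by have := ler_wpM2r (enorm_ge0 u) (ltW ch); lra.
have key e : dot (grad g p - grad g q - hessv g x (p - q)) e <=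
    L * rho' * enorm (p - q) * enorm e.
  apply: (@hess_increment g (L * rho') rho' x x) => //.
    by move=> y /le_trans/(_ hrho); exact: dgg.
  move=> y w yr; apply: le_trans (hL y w e (le_trans yr hrho)) _.
  rewrite -!mulrA; apply: ler_wpM2l => //; apply: ler_wpM2r => //.
  by rewrite mulr_ge0 ?enorm_ge0.
have hv : hessv g x (p - q) = h *: hessv g x v.
  by rewrite pE /hessv linearZ/= -scalemxAr linearZ.
have := key u; have := key (- u).
rewrite dotNr enormN !dotBl hv dotZl pE enormZ gtr0_norm// => k1 k2.
rewrite ler_norml /dphi -/p -/q; have hh := ltW h0.
have := ler_wpM2l hh k1; have := ler_wpM2l hh k2.
rewrite rho'E; set N := enorm u; set N' := enorm v; set D := dot (hessv g x v) u.
have e1 : h * (L * (h * (N + N')) * (h * N') * N) = h ^+ 3 * (L * (N + N') * N' * N) by ring.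
rewrite e1; set A := dot _ _; set B := dot _ _; set K := _ ^+ 3 * _ => j1 j2.
by apply/andP; split; lra.
Qed.

(** Schwarz's theorem: the second difference is symmetric in [u] and [v] and approximates [h ^ 2]
    times either side up to [h ^ 3 * C]. Divide by [h ^ 2] and let [h] tend to 0. *)
Lemma hess_symmetric g (L rho : R) x u v : 0 < rho ->
  (forall y, differentiable g y) ->
  (forall y, enorm (y - x) <= rho -> differentiable (grad g) y) -> 0 <= L ->
  (forall y w e, enorm (y - x) <= rho ->
    dot (hessv g y w - hessv g x w) e <= L * enorm (y - x) * enorm w * enorm e) ->
  dot (hessv g x u) v = dot (hessv g x v) u.
Proof.
move=> r0 dg dgg L0 hL.
set C := L * (enorm u + enorm v) * enorm v * enorm u.
have C0 : 0 <= C by rewrite !mulr_ge0 ?addr_ge0 ?enorm_ge0.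
suff H (h : R) : 0 < h -> h * (enorm u + enorm v) <= rho ->
    `|dot (hessv g x u) v - dot (hessv g x v) u| <= 2 * C * h.
  apply/eqP; rewrite -subr_eq0 -normr_eq0 eq_le normr_ge0 andbT.
  apply/ler_addgt0Pr => e e0; rewrite add0r.
  have S0 : 0 <= enorm u + enorm v by rewrite addr_ge0 ?enorm_ge0.
  set D := `|_|.
  pose h := Num.min (rho / (enorm u + enorm v + 1)) (e / (2 * C + 1)).
  have h0 : 0 < h by rewrite lt_min !divr_gt0//; lra.
  apply: le_trans (H h h0 _) _.
    have h1 : h <= rho / (enorm u + enorm v + 1) by rewrite ge_min lexx.
    apply: le_trans (ler_wpM2r S0 h1) _.
    rewrite mulrAC ler_pdivrMr; last lra.
    by rewrite ler_wpM2l ?(ltW r0)//; lra.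
  have h2 : h <= e / (2 * C + 1) by rewrite ge_min lexx orbT.
  have : 0 <= 2 * C by lra.
  move=> /ler_wpM2l/(_ _ _ h2) h3; apply: le_trans h3 _.
  rewrite mulrA ler_pdivrMr; last lra.
  by rewrite mulrC ler_wpM2l ?(ltW e0)//; lra.
move=> h0 hr.
have := second_difference dg dgg L0 hL h0 hr.
have := second_difference (u := v) (v := u) dg dgg L0 hL h0.
rewrite [enorm v + enorm u]addrC => /(_ hr).
rewrite [x + h *: u + h *: v]addrAC -/C.
have -> : h ^+ 3 * (L * (enorm u + enorm v) * enorm u * enorm v) = h ^+ 3 * C.
  by rewrite /C; ring.
rewrite !ler_norml => /andP[a1 a2] /andP[b1 b2].
rewrite -/C in b1 b2.
have h2 : 0 < h ^+ 2 by rewrite exprn_gt0.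
have e3 : h ^+ 2 * (2 * C * h) = 2 * (h ^+ 3 * C) by ring.
move: e3 a1 a2 b1 b2; set K := _ ^+ 3 * C; set D := dot _ _; set D' := dot _ _ => e3 a1 a2 b1 b2.
by apply/andP; split; rewrite -(ler_pM2l h2) ?mulrN e3; lra.
Qed.

End LineCalculus.

(** * Symmetric operators and strict saddles *)

Section SymmetricOperators.
Context {R : realType} {d : nat}.
Implicit Types (u v w e : 'rV[R]_d) (A H : 'M[R]_d).

Definition mxop A u : 'rV[R]_d := (A *m u^T)^T.

Lemma mxopE A u : mxop A u = u *m A^T.
Proof. by rewrite /mxop trmx_mul trmxK. Qed.

Lemma mxopD A u v : mxop A (u + v) = mxop A u + mxop A v.
Proof. by rewrite !mxopE mulmxDl. Qed.

Lemma mxopZ A k u : mxop A (k *: u) = k *: mxop A u.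
Proof. by rewrite !mxopE scalemxAl. Qed.

Lemma mxopBl A H u : mxop (A - H) u = mxop A u - mxop H u.
Proof. by rewrite !mxopE linearB mulmxBr. Qed.

Lemma mxop_bound A : exists2 C, 0 <= C & forall u, enorm (mxop A u) <= C * enorm u.
Proof.
exists (\sum_i enorm (mxop A (e_ R i))).
  by apply: sumr_ge0 => i _; exact: enorm_ge0.
move=> u; rewrite {1}mxopE {1}(row_sum_delta u) mulmx_suml mulr_suml.
apply: le_trans (ler_enorm_sum _) _; apply: ler_sum => i _.
rewrite -scalemxAl enormZ mulrC -mxopE ler_wpM2l ?enorm_ge0//.
exact: coord_le_enorm.
Qed.

Lemma opnorm_le A u : enorm (mxop A u) <= opnorm A * enorm u.
Proof.
have [C C0 hC] := mxop_bound A.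
(* [opnorm] is a real supremum, which is meaningful only for a set that is bounded above. *)
have ub : has_ubound [set enorm ((A *m v^T)^T) | v in [set v : 'rV[R]_d | enorm v <= 1]].
  exists C => _ [v /= v1 <-]; apply: le_trans (hC v) _.
  by rewrite ler_piMr.
have [->|u0] := eqVneq u 0.
  by rewrite mxopE mul0mx enorm0 mulr0.
have n0 := enorm_gt0 u0.
rewrite -ler_pdivrMr//; apply: ub_le_sup => //.
exists ((enorm u)^-1 *: u) => /=.
  by rewrite enormZ gtr0_norm ?invr_gt0// mulVf ?gt_eqF.
by rewrite -/(mxop A _) mxopZ enormZ gtr0_norm ?invr_gt0// mulrC.
Qed.

Lemma psd_cauchy A u v : (forall u v, dot (mxop A u) v = dot (mxop A v) u) ->
  (forall u, 0 <= dot (mxop A u) u) ->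
  dot (mxop A u) v ^+ 2 <= dot (mxop A u) u * dot (mxop A v) v.
Proof.
move=> sym psd; set a := dot (mxop A u) u; set b := dot (mxop A u) v.
set c := dot (mxop A v) v.
have q s t : 0 <= s ^+ 2 * a + 2 * (s * t) * b + t ^+ 2 * c.
  have := psd (s *: u + t *: v).
  by rewrite mxopD !mxopZ !(dotDl, dotDr, dotZl, dotZr) (sym v u) -/a -/b -/c; lra.
have a0 : 0 <= a by exact: psd.
have c0 : 0 <= c by exact: psd.
(* If [c = 0], the quadratic form is affine in the second coefficient, and a nonzero [b] would let
   it reach [-1]. Otherwise its value at [(c, - b)] is [c * (a * c - b ^ 2)]. *)
have [c00|cn0] := eqVneq c 0.
  have [b0|bn0] := eqVneq b 0; first by rewrite b0 expr0n/= mulr_ge0.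
  have := q 1 (- (a + 1) / (2 * b)); rewrite c00.
  have -> : 1 ^+ 2 * a + 2 * (1 * (- (a + 1) / (2 * b))) * b +
     (- (a + 1) / (2 * b)) ^+ 2 * 0 = - 1 by field.
  by lra.
have cp : 0 < c by rewrite lt_def cn0.
have := q c (- b).
have -> : c ^+ 2 * a + 2 * (c * - b) * b + (- b) ^+ 2 * c = c * (a * c - b ^+ 2) by ring.
by rewrite pmulr_rge0// subr_ge0.
Qed.

(** With [w = A u], Cauchy-Schwarz for the semidefinite form gives [|w|^4 <= <Au, u> <Aw, w> <= c^2
    |u|^2 |w|^2]. A bound on the quadratic form thus becomes a bound on the operator without
    diagonalization. *)
Lemma psd_norm A (c : R) u : (forall u v, dot (mxop A u) v = dot (mxop A v) u) ->
  (forall u, 0 <= dot (mxop A u) u) ->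
  (forall u, dot (mxop A u) u <= c * enorm u ^+ 2) -> 0 <= c ->
  enorm (mxop A u) <= c * enorm u.
Proof.
move=> sym psd ub c0; set w := mxop A u.
have [->|w0] := eqVneq w 0; first by rewrite enorm0 mulr_ge0 ?enorm_ge0.
have nw := enorm_gt0 w0.
have := psd_cauchy u w sym psd; rewrite -/w -sqr_enorm => h.
have h2 : (enorm w ^+ 2) ^+ 2 <= (c * enorm u ^+ 2) * (c * enorm w ^+ 2).
  apply: le_trans h _; apply: ler_pM; [exact: psd|exact: psd|exact: ub|exact: ub].
rewrite -(@ler_pXn2r _ 2) ?nnegrE ?enorm_ge0 ?mulr_ge0 ?enorm_ge0//.
rewrite -(ler_pM2r (exprn_gt0 2 nw)); apply: le_trans h2 _.
by rewrite le_eqVlt; apply/orP; left; apply/eqP; ring.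
Qed.

(** A minimizer [v] of the quadratic form on the unit sphere makes [B = H - l I] semidefinite with
    [<Bv, v> = 0]. Cauchy-Schwarz for [B], applied to [v] and [B v], then forces [B v = 0]. *)
Lemma min_eigenvector H : (0 < d)%N ->
  (forall u v, dot (mxop H u) v = dot (mxop H v) u) ->
  exists v l, [/\ enorm v = 1, mxop H v = l *: v &
    forall u, l * enorm u ^+ 2 <= dot (mxop H u) u].
Proof.
move=> d0 sym.
pose S : set 'rV[R]_d := [set v | enorm v = 1].
have Sc : compact S.
  apply: bounded_closed_compact.
    exists 1; split; first exact: num_real.
    move=> M M1 v /= v1; rewrite [`|_|]mx_normrE; apply: bigmax_le => [|[i j] _]; first by lra.
    rewrite ord1 /=; apply: le_trans (coord_le_enorm v j) _; rewrite v1; exact: ltW.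
  rewrite (_ : S = (@enorm R d) @^-1` [set 1]); last by [].
  apply: preimage_closed; first by move=> x _; exact: enorm_continuous.
  exact: closed_eq.
have S0 : S !=set0.
  exists (e_ R (Ordinal d0)); rewrite /S/= enormE dot_e !mxE !eqxx.
  by rewrite sqrtr1.
pose f v := dot (mxop H v) v.
have fc : continuous f.
  have mc i : continuous (fun v => (mxop H v) 0 i).
    rewrite (_ : (fun v => _) = (fun v => \sum_j H i j * v 0 j)); last first.
      by apply/funext => v; rewrite /mxop !mxE; apply: eq_bigr => j _; rewrite mxE.
    apply: (@continuous_big R 'I_d +%R 0%R xpredT (@add_continuous R^o)) => j _ v.
    by apply: continuousM; [exact: cst_continuous|exact: coord_continuous].
  apply: (@continuous_big R 'I_d +%R 0%R xpredT (@add_continuous R^o)) => i _ v.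
  by apply: continuousM; [exact: mc|exact: coord_continuous].
have [v /set_mem v1 fmin] := EVT_min_rV S0 Sc (continuous_subspaceT fc).
pose l := f v.
have lmin u : l * enorm u ^+ 2 <= f u.
  have [->|u0] := eqVneq u 0.
    by rewrite enorm0 expr0n/= mulr0 /f dot0r.
  have n0 := enorm_gt0 u0.
  have : f v <= f ((enorm u)^-1 *: u).
    apply: fmin; rewrite inE /S/= enormZ gtr0_norm ?invr_gt0//.
    by rewrite mulVf ?gt_eqF.
  rewrite /f mxopZ dotZl dotZr -/(f u) mulrA -expr2 exprVn mulrC.
  by rewrite ler_pdivlMr ?exprn_gt0.
exists v, l; split=> //.
pose B := H - l%:M.
have BE u : mxop B u = mxop H u - l *: u.
  by rewrite mxopBl [mxop l%:M _]mxopE tr_scalar_mx mul_mx_scalar.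
have Bsym u w : dot (mxop B u) w = dot (mxop B w) u.
  by rewrite !BE !dotBl !dotZl sym (dotC u w).
have Bpsd u : 0 <= dot (mxop B u) u.
  by rewrite BE dotBl dotZl -sqr_enorm subr_ge0; exact: lmin.
have Bv0 : dot (mxop B v) v = 0.
  by rewrite BE dotBl dotZl -sqr_enorm v1 expr1n mulr1 subrr.
have := psd_cauchy v (mxop B v) Bsym Bpsd.
rewrite Bv0 mul0r -sqr_enorm => h.
apply/eqP; rewrite -subr_eq0 -BE; apply/eqP; apply: enorm0_eq0.
apply/eqP; rewrite -(@sqrf_eq0 R) -(@sqrf_eq0 R) eq_le h /=.
by rewrite sqr_ge0.
Qed.

Lemma not_lambda_min_ge H (c : R) : ~ lambda_min_ge H c ->
  exists2 u, 0 < enorm u & dot (mxop H u) u < c * enorm u ^+ 2.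
Proof.
move=> nH; have [lam [eig lamc]] : exists lam, eigenvalue H lam /\ lam < c.
  apply: contrapT => h; apply: nH => lam eig.
  by rewrite leNgt; apply/negP => lc; apply: h; exists lam.
have /eigenvalueP[u uH u0] := eig.
exists u; first exact: enorm_gt0.
have -> : dot (mxop H u) u = lam * enorm u ^+ 2.
  (* [eigenvalue] concerns row eigenvectors [u *m H], whereas [mxop] multiplies by columns; their
     quadratic forms agree for every matrix. *)
  rewrite -[RHS](_ : dot (u *m H) u = _); last by rewrite uH dotZl sqr_enorm.
  rewrite /dot; under eq_bigr do rewrite /mxop !mxE mulr_suml.
  rewrite exchange_big/=; apply: eq_bigr => i _; rewrite [in RHS]mxE mulr_suml.
  by apply: eq_bigr => j _; rewrite ?mxE; ring.
by rewrite ltr_pM2r// exprn_gt0// enorm_gt0.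
Qed.

End SymmetricOperators.

Section StrictSaddle.
Context {R : realType} {d : nat}.
Implicit Types (u v w e x : 'rV[R]_d) (g : 'rV[R]_d -> R^o).

Lemma ler_add_small (rho N C D A : R) : 0 < rho -> 0 <= N -> 0 <= C ->
  (forall h, 0 < h -> h * N <= rho -> D <= A + h * C) -> D <= A.
Proof.
move=> r0 N0 C0 H; apply/ler_addgt0Pr => e e0.
pose h := Num.min (rho / (N + 1)) (e / (C + 1)).
have h0 : 0 < h by rewrite lt_min !divr_gt0//; lra.
have h1 : h <= rho / (N + 1) by rewrite ge_min lexx.
have h2 : h <= e / (C + 1) by rewrite ge_min lexx orbT.
apply: le_trans (H h h0 _) _.
  apply: le_trans (ler_wpM2r N0 h1) _; rewrite mulrAC ler_pdivrMr; last lra.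
  by rewrite ler_wpM2l ?(ltW r0)//; lra.
rewrite lerD2l; apply: le_trans (ler_wpM2r C0 h2) _.
rewrite mulrAC ler_pdivrMr; last lra.
by rewrite ler_wpM2l ?(ltW e0)//; lra.
Qed.

Lemma hess_lipschitz g (alpha beta L2 : R) x : 0 < beta -> 
  assumption_A2 g alpha beta L2 -> enorm (grad g x) <= alpha ->
  forall y w e, enorm (y - x) <= beta ->
    dot (hessv g y w - hessv g x w) e <= L2 * enorm (y - x) * enorm w * enorm e.
Proof.
move=> b0 A2 gx y w e yx; have [_ _ lip] := A2 x gx.
have Bx : cball x beta x by rewrite /cball/= subrr enorm0 ltW.
have := lip y x yx Bx; set N := opnorm _ => hN.
apply: le_trans (dot_le _ _) _; rewrite ler_wpM2r ?enorm_ge0//.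
have -> : hessv g y w - hessv g x w = mxop (hess g y - hess g x) w by rewrite mxopBl.
apply: le_trans (opnorm_le _ _) _.
by rewrite ler_wpM2r ?enorm_ge0.
Qed.

(** Collects what the coupling argument needs at a noncritical point of small gradient: an escape
    direction, an expansion bound for the linearized step that matches the rate along this
    direction, and the linearization error in a ball. *)
Lemma strict_saddle g (L1 alpha beta L2 eps1 eps2 eta : R) x : (0 < d)%N ->
  0 < L1 -> 0 < beta -> 0 < L2 -> 0 < eta -> eta * L1 <= 1 -> eps1 <= alpha ->
  0 < eps2 ->
  assumption_A1 g L1 -> assumption_A2 g alpha beta L2 ->
  enorm (grad g x) <= eps1 -> ~ second_order_critical g eps1 eps2 x ->
  exists v lam, [/\ enorm v = 1, eps2 < lam <= L1, mxop (hess g x) v = - lam *: v,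
    (forall u, enorm (u - eta *: mxop (hess g x) u) <= (1 + eta * lam) * enorm u) &
    (forall rho u w, rho <= beta -> enorm (u - x) <= rho -> enorm (w - x) <= rho ->
      enorm (grad g u - grad g w - mxop (hess g x) (u - w)) <= L2 * rho * enorm (u - w))].
Proof.
move=> d0 L10 b0 L20 eta0 etaL1 ea eps20 [_ [dg lip]] A2 gx nsoc.
have gxa : enorm (grad g x) <= alpha by exact: le_trans ea.
have hL := hess_lipschitz b0 A2 gxa.
have [dgg0 _ _] := A2 x gxa.
have dgg y : enorm (y - x) <= beta -> differentiable (grad g) y by exact: dgg0.
set H := hess g x.
have xx : enorm (x - x) <= beta by rewrite subrr enorm0 ltW.
have lin (rho : R) u w : rho <= beta -> enorm (u - x) <= rho -> enorm (w - x) <= rho ->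
    enorm (grad g u - grad g w - mxop H (u - w)) <= L2 * rho * enorm (u - w).
  move=> rb ux wx; have rho0 : 0 <= rho := le_trans (enorm_ge0 _) ux.
  apply: enorm_le_dual; first by rewrite !mulr_ge0 ?enorm_ge0// ltW.
  apply: (@hess_increment _ _ g (L2 * rho) rho x x) => //.
    by move=> y yr; apply: dgg; exact: le_trans rb.
  move=> y z yr; apply: le_trans (hL y z _ (le_trans yr rb)) _.
  by rewrite !ler_wpM2r ?enorm_ge0// ler_wpM2l// ltW.
have sym u v : dot (mxop H u) v = dot (mxop H v) u.
  exact: (@hess_symmetric _ _ g L2 beta x u v b0 dg dgg (ltW L20) hL).
(* [h *: mxop H u] is a gradient increment, of norm at most [L1 * h * enorm u], up to an error of
   order [h ^ 2]; divide by [h] and let it tend to 0. *)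
have bound u : `|dot (mxop H u) u| <= L1 * enorm u ^+ 2.
  apply: (@ler_add_small beta (enorm u) (L2 * enorm u ^+ 3)) => //.
  - exact: enorm_ge0.
  - by rewrite mulr_ge0 ?exprn_ge0 ?enorm_ge0// ltW.
  move=> h h0 hu.
  have hu' : enorm (x + h *: u - x) <= h * enorm u.
    by rewrite addrAC subrr add0r enormZ gtr0_norm.
  have hx' : enorm (x - x) <= h * enorm u.
    by rewrite subrr enorm0 mulr_ge0 ?enorm_ge0// ltW.
  have l1 := lin _ _ _ hu hu' hx'.
  have l2 := lip (x + h *: u) x.
  move: l1 l2; have -> : x + h *: u - x = h *: u by rewrite addrAC subrr add0r.
  rewrite mxopZ enormZ gtr0_norm//; set Dg := grad g _ - grad g x => l1 l2.
  rewrite -(ler_pM2l h0) -{1}(gtr0_norm h0) -normrM -dotZl.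
  have -> : h *: mxop H u = Dg - (Dg - h *: mxop H u) by rewrite opprB addrCA subrr addr0.
  rewrite dotBl; apply: le_trans (ler_normB _ _) _.
  apply: le_trans (lerD (normr_dot_le _ _) (normr_dot_le _ _)) _.
  have := ler_wpM2r (enorm_ge0 u) l1; have := ler_wpM2r (enorm_ge0 u) l2.
  by set a := enorm Dg; set b := enorm (_ - _); set c := enorm u; lra.
have [v [l [v1 Hv lmin]]] := min_eigenvector d0 sym.
have vv : dot (mxop H v) v = l by rewrite Hv dotZl -sqr_enorm v1 expr1n mulr1.
have [u u0 uneg] : exists2 u, 0 < enorm u & dot (mxop H u) u < - eps2 * enorm u ^+ 2.
  by apply: not_lambda_min_ge => hmin; apply: nsoc; split.
have leps : l < - eps2.
  by rewrite -(ltr_pM2r (exprn_gt0 2 u0)); exact: le_lt_trans (lmin u) uneg.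
have lL1 : - l <= L1.
  have := bound v; rewrite vv v1 expr1n mulr1 ler_norml => /andP[? _]; lra.
exists v, (- l); split=> //; [by apply/andP; split; lra|by rewrite opprK|].
(* [eta * L1 <= 1] makes [B] semidefinite, so that its norm is governed by the least eigenvalue of
   [H] alone. *)
move=> w; pose B : 'M[R]_d := 1%:M - eta *: H.
have BE y : mxop B y = y - eta *: mxop H y.
  by rewrite /B mxopBl !mxopE tr_scalar_mx mulmx1 linearZ/= -scalemxAr.
rewrite -BE; apply: psd_norm.
- by move=> y z; rewrite !BE !dotBl !dotZl (dotC y z) sym.
- move=> y; rewrite BE dotBl dotZl -sqr_enorm subr_ge0.
  have := bound y; rewrite ler_norml => /andP[_ /(ler_wpM2l (ltW eta0)) h].
  apply: le_trans h _; rewrite mulrA -[leRHS]mul1r.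
  by rewrite ler_wpM2r// sqr_ge0.
- move=> y; rewrite BE dotBl dotZl -sqr_enorm mulrDl mul1r lerD2l.
  rewrite mulrN mulNr lerN2 -mulrA; apply: ler_wpM2l; [exact: ltW|exact: lmin].
- have : 0 <= eta * - l by rewrite mulr_ge0 ?(ltW eta0)//; lra.
  by lra.
Qed.

End StrictSaddle.

(** * Inexact gradient steps *)

Section InexactGradientDescent.
Context {R : realType} {d : nat} (g : 'rV[R]_d -> R^o) (G : 'rV[R]_d -> 'rV[R]_d).
Context (L1 a b eta : R).
Context (L10 : 0 < L1)
  (a0 : 0 <= a)
  (a20 : a <= 1 / 20)
  (b0 : 0 <= b)
  (eta0 : 0 < eta)
  (etaE : eta * L1 * (1 + a) ^+ 2 = 1 - a)
  (dg : forall y, differentiable g y)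
  (lip : forall y z, enorm (grad g y - grad g z) <= L1 * enorm (y - z))
  (oracle : inexact_oracle g G a b).
Implicit Types (x u v y : 'rV[R]_d) (r : R).

Local Lemma etaL1 : 0 < eta * L1 /\ eta * L1 * (1 + a) <= 1.
Proof.
have k0 : 0 < eta * L1 by rewrite mulr_gt0.
split=> //; have a1 : 0 < 1 + a by have := a0; lra.
rewrite -(ler_pM2r a1) -[leLHS]mulrA -expr2 etaE.
by have := a0; lra.
Qed.

Lemma etaL1_le1 : eta * L1 <= 1.
Proof.
have [k0 k1] := etaL1; apply: le_trans k1; rewrite ler_peMr ?(ltW k0)//; have := a0; lra.
Qed.

Lemma enorm_oracle_dir x u r : enorm u <= r ->
  enorm (G x + u) <= (1 + a) * enorm (grad g x) + (b + r).
Proof.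
move=> ur; have -> : G x + u = grad g x - (grad g x - G x) + u.
  by rewrite opprB addrC [grad g x + _]addrC subrK addrC.
apply: le_trans (ler_enormD _ _) _; have := ler_enormB (grad g x) (grad g x - G x).
by have := oracle x; lra.
Qed.

(** By [etaE] the second-order term of the descent lemma consumes exactly half of the gain
    [(1 - a) V ^ 2], where [V] is the gradient norm. A further quarter absorbs the oracle error [b].
    The term [2 r V] stays linear because it is later compared with [F] through the smallness of
    [V]. *)
Lemma perturbed_step x u r : 0 <= r -> enorm u <= r ->
  g (x - eta *: (G x + u)) <= g x
    - eta * ((1 - a) / 4 * enorm (grad g x) ^+ 2 - 2 * r * enorm (grad g x)
             - 6 * b ^+ 2 - r ^+ 2).
Proof.
have A0 := a0; have A20 := a20; have B0 := b0; move=> r0 ur; have := descent_lemma x (- (eta *: (G x + u))) dg lip.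
rewrite dotNr dotZr enormN enormZ gtr0_norm//.
have hdir := enorm_oracle_dir x ur.
set V := enorm (grad g x) in hdir *; set W := enorm (G x + u) in hdir *.
set c := b + r in hdir; have V0 : 0 <= V := enorm_ge0 _.
have W0 : 0 <= W := enorm_ge0 _; have c0 : 0 <= c by rewrite addr_ge0.
have [k0 k1] := etaL1; set k := eta * L1 in k0 k1.
have hdot : V ^+ 2 - V * (a * V + c) <= dot (grad g x) (G x + u).
  have -> : G x + u = grad g x - (grad g x - G x - u).
    by apply/rowP => i; rewrite !mxE; ring.
  rewrite dotBr -sqr_enorm -/V lerB//; apply: le_trans (dot_le _ _) _.
  rewrite -/V ler_wpM2l//; apply: le_trans (ler_enormB _ _) _.
  by have := oracle x; rewrite -/V /c; lra.
have hW : k * W ^+ 2 <= (1 - a) * V ^+ 2 + 2 * c * V + c ^+ 2.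
  apply: (@le_trans _ _ (k * ((1 + a) * V + c) ^+ 2)).
    by rewrite ler_pM2l// ler_sqr ?nnegrE// (le_trans W0).
  have -> : k * ((1 + a) * V + c) ^+ 2 =
     (k * (1 + a) ^+ 2) * V ^+ 2 + (k * (1 + a)) * (2 * c * V) + k * c ^+ 2 by ring.
  rewrite /k etaE -/k lerD//; last by rewrite ler_piMl ?sqr_ge0// etaL1_le1.
  by rewrite lerD2l ler_piMl// !mulr_ge0.
(* Young's inequality with weight 5: what remains is [V ^ 2 / 5], and [1 / 5 <= (1 - a) / 4] since
   [a <= 1 / 20]. *)
have hb : 2 * b * V <= (1 - a) / 4 * V ^+ 2 + 5 * b ^+ 2.
  have : 0 <= 5 * (b - V / 5) ^+ 2 by rewrite mulr_ge0// sqr_ge0.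
  have : 0 <= (1 / 20 - a) * V ^+ 2 by rewrite mulr_ge0 ?sqr_ge0//; lra.
  by have := sqr_ge0 V; rewrite !expr2; lra.
have hc : c ^+ 2 <= 2 * b ^+ 2 + 2 * r ^+ 2.
  by have := sqr_ge0 (b - r); rewrite /c !expr2; lra.
have {}hdot := ler_wpM2l (ltW eta0) hdot.
have {}hW := ler_wpM2l (ltW eta0) hW.
have {}hb := ler_wpM2l (ltW eta0) hb; have {}hc := ler_wpM2l (ltW eta0) hc.
move=> h; apply: (le_trans h).
have -> : L1 / 2 * (eta * W) ^+ 2 = eta * (k * W ^+ 2) / 2 by rewrite /k; field.
move: hdot hW hb hc; rewrite /c; set D := dot _ _; set W' := k * _.
by rewrite !expr2 => *; lra.
Qed.

(** The squared step contains [2 eta (1 - a) V ^ 2] after multiplication by [L1], where [V] is the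
    gradient norm, and one step gains [eta (1 - a) / 4 * V ^ 2]; their ratio is 8. *)
Lemma perturbed_step_length x u r : 0 <= r -> enorm u <= r ->
  enorm (eta *: (G x + u)) ^+ 2 <= 8 / L1 * (g x - g (x - eta *: (G x + u))
     + eta * (2 * r * enorm (grad g x) + 7 * b ^+ 2 + 2 * r ^+ 2)).
Proof.
have A0 := a0; have A20 := a20; have B0 := b0; move=> r0 ur; have := perturbed_step x r0 ur.
have hdir := enorm_oracle_dir x ur; rewrite enormZ gtr0_norm//.
set V := enorm (grad g x) in hdir *; set W := enorm (G x + u) in hdir *.
set g' := g (x - _); have V0 : 0 <= V := enorm_ge0 _.
have W0 : 0 <= W := enorm_ge0 _ => hstep.
have hW : W ^+ 2 <= 2 * (1 + a) ^+ 2 * V ^+ 2 + 4 * b ^+ 2 + 4 * r ^+ 2.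
  apply: (@le_trans _ _ (((1 + a) * V + (b + r)) ^+ 2)).
    by rewrite ler_sqr ?nnegrE// (le_trans W0).
  have := sqr_ge0 ((1 + a) * V - (b + r)); have := sqr_ge0 (b - r).
  by rewrite !expr2; lra.
rewrite [8 / L1]mulrC -[leRHS]mulrA ler_pdivlMl// exprMn.
have hW2 := ler_wpM2l (_ : 0 <= L1 * eta ^+ 2) hW.
rewrite mulrA; apply: le_trans (hW2 _) _; first by rewrite mulr_ge0 ?sqr_ge0// ltW.
have -> : L1 * eta ^+ 2 * (2 * (1 + a) ^+ 2 * V ^+ 2 + 4 * b ^+ 2 + 4 * r ^+ 2) =
   2 * eta * (eta * L1 * (1 + a) ^+ 2) * V ^+ 2
   + eta * (eta * L1 * (4 * b ^+ 2 + 4 * r ^+ 2)) by ring.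
rewrite etaE.
have hk : eta * L1 * (4 * b ^+ 2 + 4 * r ^+ 2) <= 4 * b ^+ 2 + 4 * r ^+ 2.
  by rewrite ler_piMl ?etaL1_le1// addr_ge0// mulr_ge0// sqr_ge0.
have {}hk := ler_wpM2l (ltW eta0) hk.
have hb : 0 <= eta * b ^+ 2 by rewrite mulr_ge0 ?sqr_ge0// ltW.
have hr : 0 <= eta * r ^+ 2 by rewrite mulr_ge0 ?sqr_ge0// ltW.
move: hstep hk; set K := eta * (eta * L1 * _) => hstep hk.
by lra.
Qed.

Definition gd_step x := x - eta *: G x.

(** One epoch of the algorithm: the perturbation enters the first step only, and [n] counts that
    step. *)
Definition perturbed_gd x u (n : nat) :=
  if n is m.+1 then iter m gd_step (x - eta *: (G x + u)) else x.

Lemma perturbed_gdS x u n : (0 < n)%N ->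
  perturbed_gd x u n.+1 = gd_step (perturbed_gd x u n).
Proof. by case: n. Qed.

Lemma gd_descent x : g (gd_step x) <= g x + eta * (7 * b ^+ 2).
Proof.
have u0 : enorm (0 : 'rV[R]_d) <= 0 by rewrite enorm0.
have := perturbed_step x (lexx 0) u0; rewrite addr0 -/(gd_step x) => h.
apply: le_trans h _; rewrite -mulrN lerD2l ler_pM2l//.
have : 0 <= (1 - a) / 4 * enorm (grad g x) ^+ 2.
  by rewrite mulr_ge0 ?sqr_ge0//; have := a20; lra.
by have := sqr_ge0 b; rewrite !expr0n/=; lra.
Qed.

Lemma perturbed_gd_descent x u n k : (0 < n)%N ->
  g (perturbed_gd x u (n + k)) <= g (perturbed_gd x u n) + k%:R * (eta * (7 * b ^+ 2)).
Proof.
move=> n0; elim: k => [|k IH]; first by rewrite addn0 mul0r addr0.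
rewrite addnS perturbed_gdS ?addn_gt0 ?n0//; apply: le_trans (gd_descent _) _.
by move: IH; rewrite -[k.+1%:R]natr1; set Q := eta * _; lra.
Qed.

Lemma half_young (s theta : R) : 0 < theta -> s <= theta / 2 + s ^+ 2 / (2 * theta).
Proof.
move=> t0; rewrite -subr_ge0.
have -> : theta / 2 + s ^+ 2 / (2 * theta) - s = (theta - s) ^+ 2 / (2 * theta).
  by field; rewrite gt_eqF.
by rewrite divr_ge0 ?sqr_ge0// mulr_ge0// ltW.
Qed.

(* "Improve or localize": each step is bounded by [theta / 2 + step^2 / (2 theta)],
   and the squared steps are paid for by the decrease of [g]. *)
Lemma perturbed_gd_path x u r theta n : 0 < theta -> 0 <= r -> enorm u <= r ->
  enorm (perturbed_gd x u n.+1 - x) <= n.+1%:R * (theta / 2) +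
    8 / L1 * (g x - g (perturbed_gd x u n.+1)
      + eta * (2 * r * enorm (grad g x) + 2 * r ^+ 2)
      + n.+1%:R * (eta * (7 * b ^+ 2))) / (2 * theta).
Proof.
move=> t0 r0 ur; have t20 : 0 < (2 * theta)^-1 by rewrite invr_gt0 mulr_gt0.
elim: n => [|n IH].
  rewrite /= addrAC subrr add0r enormN !mul1r.
  apply: le_trans (half_young _ t0) _; rewrite lerD2l ler_pM2r//.
  apply: le_trans (perturbed_step_length x r0 ur) _.
  rewrite ler_pM2l ?divr_gt0//; set A := g x - _.
  by rewrite le_eqVlt; apply/orP; left; apply/eqP; ring.
set y := perturbed_gd x u n.+1 in IH *.
have -> : perturbed_gd x u n.+2 = gd_step y by rewrite perturbed_gdS.
have -> : gd_step y - x = (y - x) - eta *: (G y + 0).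
  by rewrite addr0 /gd_step addrAC.
have u0 : enorm (0 : 'rV[R]_d) <= 0 by rewrite enorm0.
have := perturbed_step_length y (lexx 0) u0.
have -> : y - eta *: (G y + 0) = gd_step y by rewrite addr0.
set s := enorm (eta *: _) => hs.
apply: le_trans (ler_enormB _ _) _; rewrite -/s.
apply: le_trans (lerD IH (half_young s t0)) _.
have {}hs : s ^+ 2 / (2 * theta) <= 8 / L1 * (g y - g (gd_step y) + eta * (7 * b ^+ 2)) / (2 * theta).
  rewrite ler_pM2r//; apply: le_trans hs _; rewrite ler_pM2l ?divr_gt0//.
  by rewrite !expr0n/= !(mulr0, mul0r, add0r, addr0).
apply: le_trans (lerD (lexx _) (lerD (lexx _) hs)) _.
rewrite -[n.+2%:R]natr1; set m := n.+1%:R; set Q := eta * (_ + _); set B := eta * (7 * _).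
by rewrite le_eqVlt; apply/orP; left; apply/eqP; ring.
Qed.

(** With [theta = rho / N], both the linear part and the energy part of [perturbed_gd_path] are at
    most [rho / 2]. *)
Lemma perturbed_gd_localized x u r rho F (N n : nat) : 0 < rho -> 0 <= r -> enorm u <= r ->
  N%:R * (8 / L1 * (F + eta * (2 * r * enorm (grad g x) + 2 * r ^+ 2)
    + N%:R * (eta * (7 * b ^+ 2)))) <= rho ^+ 2 ->
  g x - F < g (perturbed_gd x u N) -> (n <= N)%N ->
  enorm (perturbed_gd x u n - x) <= rho.
Proof.
move=> rho0 r0 ur small stuck; case: n => [_|n nN].
  by rewrite /= subrr enorm0 ltW.
have N0 : 0 < N%:R :> R by rewrite ltr0n (leq_trans _ nN).
have theta0 : 0 < rho / N%:R by rewrite divr_gt0.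
apply: le_trans (perturbed_gd_path x n theta0 r0 ur) _.
set Q := eta * (_ + _) in small *; set B := eta * (7 * _) in small *.
set gn := g (perturbed_gd x u n.+1).
have hn : n.+1%:R <= N%:R :> R by rewrite ler_nat.
have B0 : 0 <= B by rewrite mulr_ge0 ?(ltW eta0)// mulr_ge0// sqr_ge0.
(* Being stuck is a condition at time [N] only. It passes to earlier times because [g] rises by at
   most [B] per unperturbed step. *)
have gN : g (perturbed_gd x u N) <= gn + (N%:R - n.+1%:R) * B.
  rewrite -natrB//; have := @perturbed_gd_descent x u n.+1 (N - n.+1) isT.
  by rewrite subnKC.
have h1 : n.+1%:R * (rho / N%:R / 2) <= rho / 2.
  apply: le_trans (ler_wpM2r _ hn) _; first by rewrite !divr_ge0// ltW.
  by rewrite le_eqVlt; apply/orP; left; apply/eqP; field; rewrite gt_eqF.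
have h2 : 8 / L1 * (g x - gn + Q + n.+1%:R * B) <= 8 / L1 * (F + Q + N%:R * B).
  by rewrite ler_pM2l ?divr_gt0//; move: gN; rewrite mulrBl; lra.
have h3 : 8 / L1 * (F + Q + N%:R * B) / (2 * (rho / N%:R)) <= rho / 2.
  have -> : 8 / L1 * (F + Q + N%:R * B) / (2 * (rho / N%:R)) =
      N%:R * (8 / L1 * (F + Q + N%:R * B)) / (2 * rho).
    by field; rewrite !gt_eqF.
  rewrite ler_pdivrMr ?mulr_gt0//; apply: le_trans small _.
  by rewrite expr2; lra.
have h4 : 8 / L1 * (g x - gn + Q + n.+1%:R * B) / (2 * (rho / N%:R)) <=
    8 / L1 * (F + Q + N%:R * B) / (2 * (rho / N%:R)).
  by rewrite ler_pM2r// invr_gt0 mulr_gt0.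
by move: (le_trans h4 h3) h1; lra.
Qed.

End InexactGradientDescent.

(** * Exponential separation of two coupled runs *)

Section Coupling.
Context {R : realType} {d : nat} (g : 'rV[R]_d -> R^o) (G : 'rV[R]_d -> 'rV[R]_d).
Implicit Types (x u v y z : 'rV[R]_d).

(* Up to the error [q n], the difference of the two runs follows the linearized
   recursion, which multiplies [v] by [1 + eta * lam] at each step. *)
Lemma perturbed_gd_gap (L1 L2 a b eta eps1 rho lam s : R) x v u u' (N : nat) :
  0 <= L1 -> 0 <= L2 -> 0 <= a -> 0 <= b -> 0 < eta -> 0 < lam ->
  (forall y z, enorm (grad g y - grad g z) <= L1 * enorm (y - z)) ->
  inexact_oracle g G a b -> enorm (grad g x) <= eps1 ->
  enorm v = 1 -> mxop (hess g x) v = - lam *: v ->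
  (forall y, enorm (y - eta *: mxop (hess g x) y) <= (1 + eta * lam) * enorm y) ->
  (forall y z, enorm (y - x) <= rho -> enorm (z - x) <= rho ->
     enorm (grad g y - grad g z - mxop (hess g x) (y - z)) <= L2 * rho * enorm (y - z)) ->
  (forall n, (n <= N.+1)%N -> enorm (perturbed_gd G eta x u n - x) <= rho) ->
  (forall n, (n <= N.+1)%N -> enorm (perturbed_gd G eta x u' n - x) <= rho) ->
  u = u' + s *: v ->
  N%:R * (eta * (L2 * rho * (3 / 2 * (eta * `|s|)) + 2 * (a * (eps1 + L1 * rho) + b)))
    <= eta * `|s| / 2 ->
  eta * `|s| * (1 + eta * lam) ^+ N <= 4 * rho.
Proof.
move=> L10 L20 a0 b0 eta0 lam0 lip oracle gx v1 Hv contr lin locu locu' uu' small.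
set H := hess g x in Hv contr lin.
set E := a * (eps1 + L1 * rho) + b in small *.
set sigma := eta * `|s| in small *; set K := eta * _ in small.
set Lam := 1 + eta * lam in contr *.
have rho0 : 0 <= rho := le_trans (enorm_ge0 _) (locu 0 isT).
have Lam1 : 1 <= Lam by rewrite /Lam lerDl mulr_ge0// ltW.
have Lamn n : 1 <= Lam ^+ n by rewrite exprn_ege1.
have sigma0 : 0 <= sigma by rewrite mulr_ge0// ltW.
(* Time is shifted by one: after the first step the oracle term [G x] cancels and the difference is
   exactly [- (eta * s) *: v], which also explains the plus sign in [q]. *)
pose X n := perturbed_gd G eta x u n.+1; pose Y n := perturbed_gd G eta x u' n.+1.
have XS n : X n.+1 = X n - eta *: G (X n) by [].
have YS n : Y n.+1 = Y n - eta *: G (Y n) by [].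
pose z n := X n - Y n.
pose q n := z n + (eta * s * Lam ^+ n) *: v.
have q0 : q 0 = 0.
  rewrite /q /z /X /Y /= uu' expr0; apply/rowP => i; rewrite !mxE; ring.
have E0 : 0 <= E.
  rewrite addr_ge0// mulr_ge0// addr_ge0 ?mulr_ge0//; exact: le_trans (enorm_ge0 _) gx.
have K0 : 0 <= K.
  rewrite mulr_ge0 ?(ltW eta0)// addr_ge0 ?mulr_ge0//; lra.
have err y : enorm (y - x) <= rho -> enorm (grad g y - G y) <= E.
  move=> yr; apply: le_trans (oracle y) _; rewrite lerD2r ler_wpM2l//.
  have -> : grad g y = grad g x + (grad g y - grad g x) by rewrite addrC subrK.
  apply: le_trans (ler_enormD _ _) _; apply: lerD => //.
  by apply: le_trans (lip _ _) _; rewrite ler_wpM2l.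
(* The bounds on [q] and [z] support each other: [n K <= sigma / 2] yields
   [enorm (z n) <= 3 / 2 * sigma * Lam ^ n], and this controls the linearization error of the next
   step. *)
have claim n : (n <= N)%N -> enorm (q n) <= n%:R * K * Lam ^+ n.
  elim: n => [|n IH] nN; first by rewrite q0 enorm0 !mul0r.
  have {}IH := IH (ltnW nN).
  have Xr : enorm (X n - x) <= rho by apply: locu; rewrite ltnS ltnW.
  have Yr : enorm (Y n - x) <= rho by apply: locu'; rewrite ltnS ltnW.
  pose e1 := grad g (X n) - grad g (Y n) - mxop H (z n).
  pose e2 := grad g (X n) - G (X n); pose e3 := grad g (Y n) - G (Y n).
  have qS : q n.+1 = (q n - eta *: mxop H (q n)) - eta *: (e1 - (e2 - e3)).
    rewrite /q mxopD mxopZ Hv /e1 /e2 /e3 /z XS YS exprS /Lam.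
    set h := mxop H _; apply/rowP => i; rewrite !mxE; ring.
  have zle : enorm (z n) <= 3 / 2 * sigma * Lam ^+ n.
    have -> : z n = q n - (eta * s * Lam ^+ n) *: v by rewrite /q addrK.
    apply: le_trans (ler_enormB _ _) _.
    rewrite enormZ v1 mulr1 2!normrM (gtr0_norm eta0) -/sigma.
    rewrite (ger0_norm (le_trans ler01 (Lamn n))).
    apply: le_trans (lerD IH (lexx _)) _; rewrite -mulrDl ler_wpM2r ?(le_trans ler01 (Lamn n))//.
    have : n%:R * K <= N%:R * K by rewrite ler_wpM2r// ler_nat ltnW.
    by move: small; lra.
  have e1le : enorm e1 <= L2 * rho * enorm (z n) by apply: lin.
  have he : enorm (eta *: (e1 - (e2 - e3))) <= K * Lam ^+ n.
    rewrite enormZ gtr0_norm// /K -mulrA ler_pM2l//.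
    apply: le_trans (ler_enormB _ _) _.
    have h23 := le_trans (ler_enormB e2 e3) (lerD (err _ Xr) (err _ Yr)).
    apply: le_trans (lerD e1le h23) _; rewrite mulrDl; apply: lerD.
      by rewrite -[leRHS]mulrA ler_wpM2l ?mulr_ge0.
    by have := ler_wpM2l E0 (Lamn n); set A := Lam ^+ n; lra.
  rewrite qS; apply: le_trans (ler_enormB _ _) _.
  apply: le_trans (lerD (contr _) he) _.
  have h1 := ler_wpM2l (le_trans ler01 Lam1) IH.
  apply: le_trans (lerD h1 (lexx _)) _.
  have h2 : K * Lam ^+ n <= K * Lam ^+ n.+1.
    by rewrite ler_wpM2l// exprS ler_peMl ?(le_trans ler01 (Lamn n)).
  rewrite -[n.+1%:R]natr1.
  have -> : (n%:R + 1) * K * Lam ^+ n.+1 = Lam * (n%:R * K * Lam ^+ n) + K * Lam ^+ n.+1.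
    by rewrite exprS; ring.
  exact: lerD.
have zN : enorm (z N) <= 2 * rho.
  have -> : z N = (X N - x) - (Y N - x) by rewrite /z opprB addrA subrK.
  apply: le_trans (ler_enormB _ _) _.
  by have := locu N.+1 (leqnn _); have := locu' N.+1 (leqnn _); rewrite /X /Y; lra.
have main : enorm ((eta * s * Lam ^+ N) *: v) = sigma * Lam ^+ N.
  rewrite enormZ v1 mulr1 2!normrM (gtr0_norm eta0) -/sigma.
  by rewrite (ger0_norm (le_trans ler01 (Lamn N))).
have : enorm ((eta * s * Lam ^+ N) *: v) <= enorm (q N) + enorm (z N).
  have -> : (eta * s * Lam ^+ N) *: v = q N - z N by rewrite /q addrAC subrr add0r.
  exact: ler_enormB.
rewrite main => h.
have := claim N (leqnn _) => h2.
have h3 : N%:R * K * Lam ^+ N <= sigma / 2 * Lam ^+ N.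
  by rewrite ler_wpM2r ?(le_trans ler01 (Lamn N)).
have h4 : sigma / 2 * Lam ^+ N = sigma * Lam ^+ N / 2 by ring.
by rewrite h4 in h3; move: (le_trans h2 h3) h zN; lra.
Qed.

End Coupling.

(** * Runs of the algorithm: measurability, dependence on the past, epochs, descent *)

Section PIGD.
Context {R : realType} {d : nat} (g : 'rV[R]_d -> R^o) (G : 'rV[R]_d -> 'rV[R]_d).
Implicit Types (x u : 'rV[R]_d) (w : nat -> 'rV[R]_d).

Lemma measurable_perturbed_gd (eta : R) x n : borel_measurable G ->
  measurable_fun setT ((fun u => perturbed_gd G eta x u n) : borelV d -> borelV d).
Proof.
move=> mG; have mGV : measurable_fun setT (G : borelV d -> borelV d).
  apply: (@measurability _ _ (borelV d) (borelV d) setT G (@open 'rV[R]_d)) => //.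
  by move=> _ [A oA <-]; rewrite setTI; exact: mG.
have mstep (f : borelV d -> borelV d) (h : borelV d -> borelV d) :
    measurable_fun setT f -> measurable_fun setT h ->
    measurable_fun setT ((fun u => f u - eta *: h u) : borelV d -> borelV d).
  move=> mf mh; apply: measurable_funV => i.
  rewrite (_ : (fun _ => _) = (fun u => (f u : 'rV[R]_d) 0 i - eta * (h u : 'rV[R]_d) 0 i)).
    apply: measurable_funB; last apply: measurable_funM => //.
      by apply: (measurableT_comp (measurable_coord i)).
    by apply: (measurableT_comp (measurable_coord i)).
  by apply/funext => u; rewrite !mxE.
case: n => [|n] /=; first exact: measurable_cst.
elim: n => [|n IH] /=.
  apply: (mstep (fun=> x) (fun u => G x + u)); first exact: measurable_cst.
  rewrite (_ : (fun u => G x + u) = (fun u => u + G x)); first exact: measurable_shiftV.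
  by apply/funext => u; rewrite addrC.
apply: (mstep _ _ IH); exact: (measurableT_comp mGV IH).
Qed.

Definition stuck_set (eta rad F : R) (N : nat) x : set 'rV[R]_d :=
  [set u | cball 0 rad u /\ g x - F < g (perturbed_gd G eta x u N)].

Lemma measurable_stuck_set (eta rad F : R) N x : borel_measurable G ->
  continuous g -> measurable (stuck_set eta rad F N x : set (borelV d)).
Proof.
move=> mG cg.
rewrite (_ : stuck_set _ _ _ _ _ = cball 0 rad `&`
  ((fun u => g (perturbed_gd G eta x u N)) : borelV d -> R) @^-1` `]g x - F, +oo[).
  apply: measurableI; first exact: measurable_cballV.
  rewrite -[X in measurable X]setTI.
  apply: (measurableT_comp (continuous_measurableV cg)) => //.
  exact: measurable_perturbed_gd.
by apply/seteqP; split => u; rewrite /= in_itv/= andbT.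
Qed.

Context (eta M eps1 : R) (x0 : 'rV[R]_d).

Local Notation state w n := (pigd_state G eta M eps1 x0 w n).
Local Notation iterate w n := (pigd_iterate G eta M eps1 x0 w n).

Definition restart w n : bool := M <= n%:R - (state w n).2.
Definition triggers w n : bool := (enorm (G (iterate w n)) <= eps1 / 2) && restart w n.

Lemma pigd_state_past w w' n : (forall i, (i < n)%N -> w i = w' i) ->
  state w n = state w' n.
Proof.
elim: n => [//|n IH] ww' /=; rewrite IH ?(ww' n)// => i ik.
by apply: ww'; exact: ltnW.
Qed.

(** Fewer than [N] steps after a perturbation, the elapsed time is at most [N - 1 < M], so no new
    perturbation can be triggered. *)
Lemma pigd_epoch w n k (N : nat) : N%:R < M + 1 -> (k < N)%N -> triggers w n ->
  state w (n + k.+1)%N = (perturbed_gd G eta (iterate w n) (w n) k.+1, n%:R).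
Proof.
move=> NM; elim: k => [|k IH] kN tr.
  by move: (tr); rewrite addn1 /triggers /restart /pigd_iterate /= => ->.
have st := IH (ltnW kN) tr.
have nM : (M <= (n + k.+1)%:R - n%:R) = false.
  apply/negbTE; rewrite -ltNge natrD addrAC subrr add0r -(ltrD2r 1).
  by rewrite natr1 (le_lt_trans _ NM)// ler_nat.
by rewrite addnS [LHS]/= st /= nM andbF addr0.
Qed.

Lemma triggers_past w w' n : (forall i, (i < n)%N -> w i = w' i) ->
  triggers w n = triggers w' n.
Proof. by move=> /pigd_state_past e; rewrite /triggers /restart /pigd_iterate e. Qed.

(* [m] ranges over the times at which a perturbation is allowed: from such a time
   either one large-gradient step or a whole perturbation epoch of [N] steps leads
   to the next one, and both lower [g] by at least [rate] per step. *)
Lemma pigd_descent w (N T0 : nat) (F rate : R) :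
  M <= N%:R < M + 1 -> (0 < N)%N -> 0 <= rate -> rate * N%:R <= F ->
  (forall x, eps1 / 2 < enorm (G x) -> g (gd_step G eta x) <= g x - rate) ->
  (forall n, (n < T0)%N -> triggers w n ->
     g (perturbed_gd G eta (iterate w n) (w n) N) <= g (iterate w n) - F) ->
  exists n, g (iterate w n) <= g x0 - rate * T0%:R.
Proof.
move=> /andP[MN NM] N0 rate0 rateF large small.
suff [m [_ T0m gm]] : exists m, [/\ restart w m, (T0 <= m)%N &
    g (iterate w m) <= g x0 - rate * m%:R].
  exists m; apply: le_trans gm _; rewrite lerD2l lerN2.
  by rewrite ler_wpM2l// ler_nat.
have : (T0 <= T0)%N by [].
elim: {-2}T0 => [_|n IH nT].
  (* The initial value [- M] of the perturbation time is what allows a perturbation at time 0. *)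
  exists 0%N; split=> //; last by rewrite mulr0 subr0.
  by rewrite /restart /= sub0r opprK.
have [m [rm nm gm]] := IH (ltnW nT).
move: nm; rewrite leq_eqVlt => /orP[/eqP nm|nm]; last by exists m.
rewrite -{}nm in rm gm; have [tr|ntr] := boolP (triggers w n).
  have := small n nT tr; case: N => // N in MN NM N0 rateF small *.
  have stN := pigd_epoch NM (ltnSn N) tr; rewrite addnS in stN.
  move=> gN; exists (n + N).+1; split.
  - by rewrite /restart stN /= -addnS natrD addrAC subrr add0r.
  - by rewrite ltnS leq_addr.
  rewrite /pigd_iterate stN [X in g X]/=; apply: le_trans gN _.
  by rewrite -addnS natrD mulrDr; move: gm rateF; lra.
have stS : state w n.+1 = (gd_step G eta (iterate w n), (state w n).2).
  by rewrite [LHS]/= (_ : _ && _ = false) ?addr0//; exact: negbTE.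
exists n.+1; split=> //.
  rewrite /restart stS /=; apply: le_trans rm _.
  by rewrite lerD2r ler_nat.
rewrite /pigd_iterate stS [X in g X]/=.
have Gl : eps1 / 2 < enorm (G (iterate w n)).
  by rewrite ltNge; apply: contra ntr => Gs; rewrite /triggers Gs.
by have := large _ Gl; move: gm; rewrite -[n.+1%:R]natr1; lra.
Qed.

End PIGD.

(** * Parameter estimates *)

Section Logarithms.
Context {R : realType}.
Implicit Types x l phi gamma : R.

Lemma ln2_gt0 : 0 < ln 2 :> R.
Proof. by rewrite ln_gt0// ltr1n. Qed.

Lemma ln2_ge : 1 / 2 <= ln 2 :> R.
Proof.
have : ln (1 + (- (1 / 2))) <= - (1 / 2) :> R by apply: le_ln1Dx; lra.
rewrite (_ : 1 + - (1 / 2) = 2^-1 :> R); last by field.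
by rewrite lnV ?posrE//; lra.
Qed.

(** By convexity, [2 ^ x] lies below its chord between 0 and 1. *)
Lemma powR2_le1Dx x : 0 <= x <= 1 -> 2 `^ x <= 1 + x.
Proof.
move=> /andP[x0 x1]; rewrite /powR pnatr_eq0/=.
have := @convex_expR R (Itv01 x0 x1) (ln 2) 0.
by rewrite !convRE/= expR0 mulr0 addr0 lnK ?posrE// /unstable.onem; lra.
Qed.

(** Both sides agree at 16; the tangent of the logarithm there has slope [1 / 16], and
    [4 / 16 <= ln 2]. *)
Lemma ln_le_quarter l : 16 <= l -> 4 * ln l <= l * ln 2.
Proof.
move=> l16; have l0 : 0 < l by lra.
have h : ln (l / 16) <= l / 16 - 1.
  have -> : l / 16 = 1 + (l / 16 - 1) by lra.
  by rewrite [X in _ <= X - 1]addrC addrK; apply: le_ln1Dx; lra.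
have h16 : ln 16 = 4 * ln 2 :> R.
  by rewrite (_ : 16 = 2 ^+ 4) ?lnXn ?mulr_natl// -natrX.
move: h; rewrite ln_div ?posrE// h16 => h.
have : 0 <= (l - 16) * (ln 2 - 1 / 2) by rewrite mulr_ge0 ?subr_ge0 ?ln2_ge//.
by lra.
Qed.

(** Here [gamma] is [l + 8 log2 l] with [l = log2 phi], and [8 log2 l <= 2 l] for [l >= 24]. *)
Lemma gamma_par_bounds phi : 2 ^+ 24 <= phi ->
  [/\ 24 <= log2 phi, log2 phi <= gamma_par phi, gamma_par phi <= 3 * log2 phi
    & 2 `^ (gamma_par phi) = phi * log2 phi ^+ 8].
Proof.
move=> hphi; have phi0 : 0 < phi by apply: lt_le_trans hphi; rewrite exprn_gt0.
have L2 := ln2_gt0.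
set l := log2 phi.
have l24 : 24 <= l.
  rewrite /l /log2 ler_pdivlMr// mulr_natl -lnXn//.
  by rewrite ler_ln ?posrE// exprn_gt0.
have l0 : 0 < l by lra.
have gE : gamma_par phi = l + 8 * ln l / ln 2.
  have lE : ln phi = l * ln 2 by rewrite /l /log2 divfK// gt_eqF.
  rewrite /gamma_par {1}/log2 -/l lnM ?posrE ?exprn_gt0// lnXn// lE -[ln l *+ 8]mulr_natl.
  by field; rewrite gt_eqF.
have lnl : 0 <= ln l by rewrite ln_ge0//; lra.
have l4 : 4 * ln l <= l * ln 2 by apply: ln_le_quarter; lra.
split=> //.
- by rewrite gE lerDl divr_ge0 ?mulr_ge0// ltW.
- have : 8 * ln l / ln 2 <= 2 * l by rewrite ler_pdivrMr//; lra.
  by rewrite gE; lra.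
rewrite /powR pnatr_eq0/= {1}/gamma_par {1}/log2 divfK ?gt_eqF//.
by rewrite lnK// posrE mulr_gt0// exprn_gt0.
Qed.

End Logarithms.

Section ParameterEstimates.
Context {R : realType}.
Implicit Types a b c x y : R.

Lemma step_factor_bounds a : 0 <= a <= 1 / 20 ->
  let K := (1 - a) / (1 + a) ^+ 2 in
  [/\ 43 / 50 <= K, K <= 1 - a, 0 < K & K * (1 + a) ^+ 2 = 1 - a].
Proof.
move=> /andP[a0 a20] K; have s0 : 0 < (1 + a) ^+ 2 by rewrite exprn_gt0//; lra.
have K1 : 43 / 50 <= K.
  rewrite /K ler_pdivlMr//; have : a ^+ 2 <= 1 / 20 * a by rewrite expr2 ler_wpM2r.
  by rewrite !expr2; lra.
split=> //; [|lra|by rewrite /K divfK// gt_eqF].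
rewrite /K ler_pdivrMr// ler_peMr//; first lra.
by rewrite exprn_ege1//; lra.
Qed.

(** Relative to [F], the terms sum to [1 + 44/100 + 1/100 + 7/38 <= 41/25], and [N <= 25/24 M] as
    [M >= 24]. Together with [M F = L1 Rr^2 / 50] this makes [41/150 Rr^2], below [9/25 Rr^2]. *)
Lemma localization_budget (L1 eps1 eta M F Rr V b r N : R) :
  0 < L1 -> 0 < eta -> 0 < F -> 24 <= M -> 0 <= N <= M + 1 -> 0 <= r ->
  0 <= V <= 11 / 20 * eps1 ->
  M * F = L1 * Rr ^+ 2 / 50 ->
  eta * M * b ^+ 2 <= F / 40 ->
  eta * (r * eps1) <= 2 / 5 * F ->
  eta * r ^+ 2 <= F / 200 ->
  N * (8 / L1 * (F + eta * (2 * r * V + 2 * r ^+ 2) + N * (eta * (7 * b ^+ 2))))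
    <= (3 / 5 * Rr) ^+ 2.
Proof.
move=> L10 eta0 F0 M24 /andP[N0 NM] r0 /andP[V0 Ve] MF hb hre hr.
have B0 : 0 <= eta * b ^+ 2 by rewrite mulr_ge0 ?sqr_ge0// ltW.
have N25 : N <= 25 / 24 * M by lra.
have t1 : N * (eta * (7 * b ^+ 2)) <= 7 / 38 * F.
  have h : N * (eta * b ^+ 2) <= 25 / 24 * M * (eta * b ^+ 2) by rewrite ler_wpM2r.
  have -> : N * (eta * (7 * b ^+ 2)) = 7 * (N * (eta * b ^+ 2)) by ring.
  have e : 25 / 24 * M * (eta * b ^+ 2) = 25 / 24 * (eta * M * b ^+ 2) by ring.
  by move: h; rewrite e; lra.
have t2 : eta * (2 * r * V) <= 44 / 100 * F.
  have h : eta * (r * V) <= 11 / 20 * (eta * (r * eps1)).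
    have := ler_wpM2l (ltW eta0) (ler_wpM2l r0 Ve).
    have -> : eta * (r * (11 / 20 * eps1)) = 11 / 20 * (eta * (r * eps1)) by ring.
    by [].
  have -> : eta * (2 * r * V) = 2 * (eta * (r * V)) by ring.
  lra.
have t : F + eta * (2 * r * V + 2 * r ^+ 2) + N * (eta * (7 * b ^+ 2)) <= 41 / 25 * F.
  have -> : eta * (2 * r * V + 2 * r ^+ 2) = eta * (2 * r * V) + 2 * (eta * r ^+ 2) by ring.
  lra.
have T0 : 0 <= F + eta * (2 * r * V + 2 * r ^+ 2) + N * (eta * (7 * b ^+ 2)).
  have := ltW F0; have := ltW eta0 => p1 p2.
  apply: addr_ge0; first apply: addr_ge0 => //.
    by apply: mulr_ge0 => //; apply: addr_ge0; rewrite !mulr_ge0 ?sqr_ge0.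
  apply: mulr_ge0 => //; apply: mulr_ge0 => //; apply: mulr_ge0; last exact: sqr_ge0.
  by rewrite ler0n.
apply: (@le_trans _ _ (25 / 24 * M * (8 / L1 * (41 / 25 * F)))).
  apply: ler_pM => //; first by apply: mulr_ge0 => //; rewrite divr_ge0// ltW.
  by rewrite ler_pM2l// divr_gt0.
have -> : 25 / 24 * M * (8 / L1 * (41 / 25 * F)) = 41 / 3 / L1 * (M * F).
  by field; rewrite gt_eqF.
rewrite MF.
have -> : 41 / 3 / L1 * (L1 * Rr ^+ 2 / 50) = 41 / 150 * Rr ^+ 2.
  by field; rewrite gt_eqF.
rewrite exprMn ler_wpM2r ?sqr_ge0// expr2.
lra.
Qed.

End ParameterEstimates.

(** * Relations between the parameters of the algorithm *)

Section ParameterIdentities.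
Context {R : realType} (L1 L2 a eps1 eps2 gamma : R).
Context (L10 : 0 < L1) (L20 : 0 < L2) (a20 : 0 <= a <= 1 / 20) (e10 : 0 < eps1)
  (e20 : 0 < eps2) (g0 : 0 < gamma).

Local Notation K := ((1 - a) / (1 + a) ^+ 2).
Local Notation F := (F_par gamma a L2 eps2).
Local Notation Rr := (R_par gamma L2 eps2).
Local Notation eta := (eta_par a L1).
Local Notation r := (r_par gamma L1 L2 eps1 eps2).
Local Notation M := (M_par gamma a L1 eps2).

Local Lemma oneDa_gt0 : 0 < 1 + a /\ 0 < 1 - a.
Proof. by have /andP[? ?] := a20; split; lra. Qed.

Lemma eta_par_gt0 : 0 < eta.
Proof.
have [p q] := oneDa_gt0.
exact: mulr_gt0 (divr_gt0 q (exprn_gt0 2 p)) (divr_gt0 ltr01 L10).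
Qed.

Lemma M_par_gt0 : 0 < M.
Proof.
have [p q] := oneDa_gt0.
exact: mulr_gt0 (mulr_gt0 (divr_gt0 (exprn_gt0 2 p) q) (divr_gt0 L10 e20)) g0.
Qed.

Lemma F_par_gt0 : 0 < F.
Proof.
have [p q] := oneDa_gt0; have c0 : 0 < 800 :> R by rewrite ltr0n.
exact: mulr_gt0 (mulr_gt0 (divr_gt0 ltr01 (mulr_gt0 c0 (exprn_gt0 3 g0)))
  (divr_gt0 q (exprn_gt0 2 p))) (divr_gt0 (exprn_gt0 3 e20) (exprn_gt0 2 L20)).
Qed.

Lemma R_par_gt0 : 0 < Rr.
Proof.
have c0 : 0 < 4 :> R by rewrite ltr0n.
exact: mulr_gt0 (divr_gt0 ltr01 (mulr_gt0 c0 g0)) (divr_gt0 e20 L20).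
Qed.

Lemma eta_par_step : eta * L1 * (1 + a) ^+ 2 = 1 - a.
Proof. by have [p q] := oneDa_gt0; rewrite /eta_par; field; rewrite !gt_eqF. Qed.

Lemma eta_M_par : eta * M = gamma / eps2.
Proof. by have [p q] := oneDa_gt0; rewrite /eta_par /M_par; field; rewrite !gt_eqF. Qed.

Lemma gamma_le_M_par : eps2 <= L1 -> gamma <= M.
Proof.
move=> e2L1; have /andP[a0 _] := a20; have eta0 := eta_par_gt0.
rewrite -(ler_pM2l eta0) eta_M_par -(ler_pM2r e20) divfK ?gt_eqF//.
rewrite mulrAC ler_piMl ?(ltW g0)//.
apply: le_trans (etaL1_le1 L10 a0 eta0 eta_par_step).
by rewrite ler_pM2l.
Qed.

Lemma M_F_par : M * F = L1 * Rr ^+ 2 / 50.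
Proof.
have [p q] := oneDa_gt0; rewrite /M_par /F_par /R_par; field; rewrite !gt_eqF//.
Qed.

Local Notation A := (eps2 ^+ 2 / (400 * L2 * gamma ^+ 3)).
Local Notation q := (L1 * eps2 / (5 * eps1 * L2)).

Local Lemma A_gt0 : 0 < A.
Proof.
have c0 : 0 < 400 :> R by rewrite ltr0n.
exact: divr_gt0 (exprn_gt0 2 e20) (mulr_gt0 (mulr_gt0 c0 L20) (exprn_gt0 3 g0)).
Qed.

Local Lemma q_gt0 : 0 < q.
Proof.
have c0 : 0 < 5 :> R by rewrite ltr0n.
exact: divr_gt0 (mulr_gt0 L10 e20) (mulr_gt0 (mulr_gt0 c0 e10) L20).
Qed.

Lemma r_par_gt0 : 0 < r.
Proof. by apply: mulr_gt0; [exact: A_gt0|rewrite lt_min ltr01 q_gt0]. Qed.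

Lemma eta_r_eps1_par : eta * (r * eps1) <= 2 / 5 * F.
Proof.
have [p p'] := oneDa_gt0.
have h : r * eps1 <= A * q * eps1.
  apply: ler_wpM2r; first exact: ltW.
  by apply: ler_wpM2l; [exact: ltW A_gt0|rewrite ge_min lexx orbT].
apply: le_trans (ler_wpM2l (ltW eta_par_gt0) h) _.
rewrite le_eqVlt; apply/orP; left; apply/eqP.
by rewrite /eta_par /F_par; field; rewrite !gt_eqF.
Qed.

Lemma eta_r2_par : 1 <= gamma -> eps2 <= L1 -> eta * r ^+ 2 <= F / 200.
Proof.
move=> g1 e2L1; have [p p'] := oneDa_gt0; have F0 := F_par_gt0.
have rA : r <= A.
  by rewrite -[leRHS]mulr1; apply: ler_wpM2l; [exact: ltW A_gt0|rewrite ge_min lexx].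
have h : r ^+ 2 <= A ^+ 2.
  by rewrite ler_sqr ?nnegrE; [|exact: ltW r_par_gt0|exact: ltW A_gt0].
apply: le_trans (ler_wpM2l (ltW eta_par_gt0) h) _.
have -> : eta * A ^+ 2 = F / 200 * ((eps2 / L1) * (gamma ^+ 3)^-1).
  by rewrite /eta_par /F_par; field; rewrite !gt_eqF.
have h3 : eps2 / L1 <= 1 by rewrite ler_pdivrMr// mul1r.
have h4 : (gamma ^+ 3)^-1 <= 1 by rewrite invf_le1 ?exprn_gt0// exprn_ege1.
have c0 : 0 < 200 :> R by rewrite ltr0n.
rewrite -[leRHS]mulr1; apply: ler_wpM2l; first exact: ltW (divr_gt0 F0 c0).
rewrite -[leRHS]mulr1; apply: ler_pM; [|by rewrite invr_ge0 exprn_ge0// ltW|exact: h3|exact: h4].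
by rewrite divr_ge0 ?ltW.
Qed.

Local Notation mm := (Num.max 1 (5 * (L2 * eps1) / (L1 * eps2))).

Local Lemma min_max_inv : (Num.min 1 q)^-1 = mm.
Proof.
have qE : 5 * (L2 * eps1) / (L1 * eps2) = q^-1 by field; rewrite !gt_eqF.
rewrite qE; have [q1|q1] := leP 1 q.
  by rewrite invr1 max_l// invf_le1// q_gt0.
by rewrite max_r// invf_ge1 ?(ltW q1)// q_gt0.
Qed.

Lemma thin_ratio_par (S P : R) : 0 < P ->
  4 * (5 * Rr / (P * eta) * S / r) = 2000 * gamma ^+ 2 * L1 * mm * S / (K * eps2 * P).
Proof.
move=> P0; have [p p'] := oneDa_gt0; rewrite -min_max_inv.
have m0 : 0 < Num.min 1 q by rewrite lt_min ltr01 q_gt0.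
rewrite /r_par /R_par /eta_par; move: (Num.min 1 q) m0 => m m0.
by field; rewrite !gt_eqF.
Qed.

Local Notation mz := (Num.max (L2 ^+ 2 / eps2 ^+ 5) (1 / (eps1 ^+ 2 * eps2))).

(** The first maximand equals its counterpart exactly, with [1600 = 2 * 800]; the second has ample
    room. *)
Lemma rate_par_le : 1 <= gamma ->
  Num.max (2 * M / F) (256 / ((1 - a) * eta * eps1 ^+ 2)) <=
  1600 * gamma ^+ 4 * L1 / K ^+ 2 * eps2 * mz.
Proof.
move=> g1; have [p p'] := oneDa_gt0; have [_ K1 K0 KE] := step_factor_bounds a20.
have c0 : 0 < 1600 :> R by rewrite ltr0n.
have C0 : 0 < 1600 * gamma ^+ 4 * L1 / K ^+ 2 * eps2.
  exact: mulr_gt0 (divr_gt0 (mulr_gt0 (mulr_gt0 c0 (exprn_gt0 4 g0)) L10) (exprn_gt0 2 K0)) e20.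
rewrite ge_max; apply/andP; split.
  have -> : 2 * M / F = 1600 * gamma ^+ 4 * L1 / K ^+ 2 * eps2 * (L2 ^+ 2 / eps2 ^+ 5).
    by rewrite /M_par /F_par; field; rewrite !gt_eqF.
  by apply: ler_wpM2l; [exact: ltW|rewrite le_max lexx].
apply: (@le_trans _ _ (1600 * gamma ^+ 4 * L1 / K ^+ 2 * eps2 * (1 / (eps1 ^+ 2 * eps2)))); last first.
  by apply: ler_wpM2l; [exact: ltW|rewrite le_max lexx orbT].
have -> : 256 / ((1 - a) * eta * eps1 ^+ 2) = L1 / eps1 ^+ 2 / K * (256 / (1 - a)).
  by rewrite /eta_par; field; rewrite !gt_eqF.
have -> : 1600 * gamma ^+ 4 * L1 / K ^+ 2 * eps2 * (1 / (eps1 ^+ 2 * eps2)) =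
    L1 / eps1 ^+ 2 / K * (1600 * gamma ^+ 4 / K).
  by field; rewrite !gt_eqF.
apply: ler_wpM2l; first exact: ltW (divr_gt0 (divr_gt0 L10 (exprn_gt0 2 e10)) K0).
apply: ler_pM; [by rewrite ler0n|by rewrite invr_ge0 ltW| |].
  apply: (@le_trans _ _ (1600 * 1)); first by rewrite mulr1 ler_nat.
  by rewrite ler_pM2l// exprn_ege1.
by rewrite lef_pV2 ?posrE.
Qed.

End ParameterIdentities.

Section FailureProbability.
Context {R : realType} (d : nat) (L1 L2 a eps1 eps2 delta Dg : R).
Context (L10 : 0 < L1) (L20 : 0 < L2) (a20 : 0 <= a <= 1 / 20) (e10 : 0 < eps1)
  (e20 : 0 < eps2) (e2L1 : eps2 < L1) (d0 : (0 < d)%N) (delta01 : 0 < delta < 1)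
  (Dg0 : 0 <= Dg).

Local Notation S := (Num.sqrt d%:R : R).
Local Notation mm := (Num.max 1 (5 * (L2 * eps1) / (L1 * eps2))).
Local Notation mz := (Num.max (L2 ^+ 2 / eps2 ^+ 5) (1 / (eps1 ^+ 2 * eps2))).
Local Notation Bk := (Dg * mz + 1 / eps2 ^+ 2).
Local Notation phi := (phi_par d L1 L2 eps1 eps2 delta Dg).

Local Lemma mz_ge0 : 0 <= mz.
Proof.
by rewrite le_max; apply/orP; left; apply: divr_ge0; apply: exprn_ge0; exact: ltW.
Qed.

Lemma sqrt_dim_ge1 : 1 <= S.
Proof. by rewrite -[leLHS]sqrtr1 ler_sqrt ?ler0n// ler1n. Qed.

Lemma phi_par_ge : 2 ^+ 24 <= phi.
Proof.
have /andP[dl0 dl1] := delta01; have S1 := sqrt_dim_ge1.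
have m1 : 1 <= mm by rewrite le_max lexx.
have LB : 1 <= L1 ^+ 2 / delta * Bk.
  apply: (@le_trans _ _ (L1 ^+ 2 * (1 / eps2 ^+ 2))).
    rewrite mul1r ler_pdivlMr ?exprn_gt0// mul1r ler_sqr ?nnegrE ?(ltW L10) ?(ltW e20)//.
    exact: ltW.
  apply: ler_pM; [exact: sqr_ge0|by rewrite divr_ge0 ?sqr_ge0| |].
    by rewrite ler_pdivlMr// ler_piMr ?sqr_ge0// ltW.
  by rewrite lerDr mulr_ge0// mz_ge0.
have -> : phi = 2 ^+ 24 * (mm * S * (L1 ^+ 2 / delta * Bk)).
  by rewrite /phi_par; move: mm S Bk (2 ^+ 24) => x1 x2 x3 x4; ring.
have mS : 1 <= mm * S by rewrite -[leLHS]mulr1; apply: ler_pM.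
rewrite ler_peMr ?exprn_ge0// -[leLHS]mulr1; apply: ler_pM => //.
Qed.

Local Notation gamma := (gamma_par phi).
Local Notation K := ((1 - a) / (1 + a) ^+ 2).
Local Notation F := (F_par gamma a L2 eps2).
Local Notation Rr := (R_par gamma L2 eps2).
Local Notation eta := (eta_par a L1).
Local Notation r := (r_par gamma L1 L2 eps1 eps2).
Local Notation M := (M_par gamma a L1 eps2).
Local Notation mx := (Num.max (2 * M / F) (256 / ((1 - a) * eta * eps1 ^+ 2))).

Lemma gamma_par_ge24 : 24 <= gamma.
Proof. by have [l1 l2 _ _] := gamma_par_bounds phi_par_ge; apply: le_trans l2. Qed.

(* [2000] and [1600] come from [thin_ratio_par] and [rate_par_le], [2 ^+ 24] from
   [phi_par], and [l ^+ 8] from [gamma_par]. *)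
Lemma constant_budget (l : R) : 24 <= l -> gamma <= 3 * l ->
  2000 * 1600 * gamma ^+ 6 <= K ^+ 3 * (2 ^+ 24 * l ^+ 8).
Proof.
move=> l24 gl; have [K1 _ K0 _] := step_factor_bounds a20.
have l0 : 0 < l by apply: lt_le_trans l24; rewrite ltr0n.
have g0 : 0 < gamma by apply: lt_le_trans gamma_par_ge24; rewrite ltr0n.
have h1 : gamma ^+ 6 <= 3 ^+ 6 * l ^+ 6.
  rewrite -exprMn; apply: lerXn2r => //; rewrite nnegrE; first exact: ltW.
  by rewrite mulr_ge0// ltW.
have h2 : 24 ^+ 2 * l ^+ 6 <= l ^+ 8.
  rewrite (_ : l ^+ 8 = l ^+ 2 * l ^+ 6); last by rewrite -exprD.
  apply: ler_wpM2r; first by rewrite exprn_ge0// ltW.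
  by apply: lerXn2r => //; rewrite nnegrE ?ler0n// ltW.
have h3 : (43 / 50) ^+ 3 <= K ^+ 3.
  by apply: lerXn2r; [rewrite nnegrE divr_ge0 ?ler0n|rewrite nnegrE (ltW K0)|].
apply: (@le_trans _ _ (2000 * 1600 * (3 ^+ 6 * l ^+ 6))).
  by apply: ler_wpM2l; [exact: mulr_ge0 (ler0n _ _) (ler0n _ _)|exact: h1].
apply: (@le_trans _ _ ((43 / 50) ^+ 3 * (2 ^+ 24 * (24 ^+ 2 * l ^+ 6)))); last first.
  apply: ler_pM.
  - exact: exprn_ge0 (divr_ge0 (ler0n _ _) (ler0n _ _)).
  - exact: mulr_ge0 (exprn_ge0 _ (ler0n _ _))
      (mulr_ge0 (exprn_ge0 _ (ler0n _ _)) (exprn_ge0 _ (ltW l0))).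
  - exact: h3.
  - by apply: ler_wpM2l; [exact: exprn_ge0 (ler0n _ _)|exact: h2].
have l60 : 0 <= l ^+ 6 by rewrite exprn_ge0// ltW.
have -> : 2000 * 1600 * (3 ^+ 6 * l ^+ 6) = (2 ^+ 10 * (3125 * 729)) * l ^+ 6 by ring.
have -> : (43 / 50) ^+ 3 * (2 ^+ 24 * (24 ^+ 2 * l ^+ 6)) =
   (2 ^+ 10 * ((43 / 50) ^+ 3 * (16384 * 576))) * l ^+ 6 by field.
apply: ler_wpM2r; first exact: l60.
apply: ler_wpM2l; first exact: exprn_ge0 (ler0n _ _).
by rewrite !exprS expr0; lra.
Qed.

(** Since [2 ^ gamma = phi l ^ 8], all of [L1], [delta], the dimension and the two maxima cancel;
    what remains is [gamma ^ 6] against [l ^ 8], as in [constant_budget]. *)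
Lemma failure_budget :
  4 * (5 * Rr / (2 `^ gamma * eta) * S / r) * (Dg * mx + 1) <= delta.
Proof.
have /andP[dl0 dl1] := delta01; have S1 := sqrt_dim_ge1.
have S0 : 0 < S by apply: lt_le_trans S1.
have [K1 K2 K0 KE] := step_factor_bounds a20.
have [p p'] : 0 < 1 + a /\ 0 < 1 - a by have /andP[? ?] := a20; split; lra.
have [l24 lg gl PE] := gamma_par_bounds phi_par_ge.
have g24 := gamma_par_ge24.
have g0 : 0 < gamma by apply: lt_le_trans g24; rewrite ltr0n.
have g1 : 1 <= gamma by apply: le_trans g24; rewrite ler1n.
have P0 : 0 < 2 `^ gamma by apply: powR_gt0.
have cb := constant_budget l24 gl.
rewrite thin_ratio_par//.
have Bk0 : 0 < Bk.
  apply: ltr_wpDl; first by rewrite mulr_ge0// mz_ge0.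
  by rewrite divr_gt0// exprn_gt0.
have m1 : 0 < mm by rewrite lt_max ltr01.
have c1600 : 0 < 1600 :> R by rewrite ltr0n.
have c2000 : 0 < 2000 :> R by rewrite ltr0n.
have C0 : 0 < 1600 * gamma ^+ 4 * L1 / K ^+ 2 * eps2.
  exact: mulr_gt0 (divr_gt0 (mulr_gt0 (mulr_gt0 c1600 (exprn_gt0 4 g0)) L10) (exprn_gt0 2 K0)) e20.
(* The summand [1 / eps2 ^ 2] in [phi] pays for the [+ 1] that comes from rounding the number of
   steps. *)
have T0 : Dg * mx + 1 <= 1600 * gamma ^+ 4 * L1 / K ^+ 2 * eps2 * Bk.
  rewrite [leRHS]mulrDr; apply: lerD.
    by rewrite [leRHS]mulrCA; apply: ler_wpM2l => //; exact: rate_par_le.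
  have -> : 1600 * gamma ^+ 4 * L1 / K ^+ 2 * eps2 * (1 / eps2 ^+ 2) =
      (1600 * gamma ^+ 4) * (L1 / eps2) * (K ^+ 2)^-1.
    by field; rewrite !gt_eqF.
  have h1 : 1 <= 1600 * gamma ^+ 4.
    rewrite -[leLHS]mulr1; apply: ler_pM; [exact: ler01|exact: ler01|by rewrite ler1n|exact: exprn_ege1].
  have h2 : 1 <= L1 / eps2 by rewrite ler_pdivlMr// mul1r ltW.
  have h3 : 1 <= (K ^+ 2)^-1.
    rewrite invf_ge1 ?exprn_gt0// exprn_ile1 ?(ltW K0)//.
    by apply: le_trans K2 _; rewrite gerBl; have /andP[] := a20.
  have h12 : 1 <= 1600 * gamma ^+ 4 * (L1 / eps2) by rewrite -[leLHS]mulr1; apply: ler_pM.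
  by rewrite -[leLHS]mulr1; apply: ler_pM.
set D := 2000 * _ ^+ 2 * _ * _ * _ / _.
have D0 : 0 < D.
  exact: divr_gt0 (mulr_gt0 (mulr_gt0 (mulr_gt0 (mulr_gt0 c2000 (exprn_gt0 2 g0)) L10) m1) S0)
    (mulr_gt0 (mulr_gt0 K0 e20) P0).
apply: le_trans (ler_wpM2l (ltW D0) T0) _.
set X := L1 ^+ 2 * mm * S * Bk.
have X0 : 0 < X.
  exact: mulr_gt0 (mulr_gt0 (mulr_gt0 (exprn_gt0 2 L10) m1) S0) Bk0.
have -> : D * (1600 * gamma ^+ 4 * L1 / K ^+ 2 * eps2 * Bk) =
    (2000 * 1600 * gamma ^+ 6) * X / (K ^+ 3 * 2 `^ gamma).
  rewrite /D /X; move: mm Bk S (2 `^ gamma) gamma P0 K K0 => x1 x2 x3 x4 x5 ? x6 ?.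
  by field; rewrite !gt_eqF.
have {}PE : 2 `^ gamma = 2 ^+ 24 * log2 phi ^+ 8 * X / delta.
  rewrite PE {1}/phi_par /X; move: mm S Bk (2 ^+ 24) (log2 _ ^+ 8) => x1 x2 x3 x4 x5.
  by field; rewrite gt_eqF.
rewrite ler_pdivrMr; last exact: mulr_gt0 (exprn_gt0 3 K0) P0.
rewrite PE; have -> : delta * (K ^+ 3 * (2 ^+ 24 * log2 phi ^+ 8 * X / delta)) =
   K ^+ 3 * (2 ^+ 24 * log2 phi ^+ 8) * X.
  have aux (x1 x2 x3 x4 : R) : delta * (x4 * (x3 * x2 * x1 / delta)) = x4 * (x3 * x2) * x1.
    by field; rewrite gt_eqF.
  exact: aux.
by apply: ler_wpM2r => //; exact: ltW.
Qed.

End FailureProbability.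

Section EscapeEstimates.
Context {R : realType}.

(** In units of [sigma]: the Hessian error gives [9/10 * 1/4], the oracle errors
    [(2 + 6/5 + 2) / 4 * 1/5]; together [0.485], below [1/2]. *)
Lemma escape_small (L1 L2 a b eps1 eta M P Rr sigma N : R) :
  0 < L1 -> 0 < L2 -> 0 <= a -> 0 <= b -> 0 < eps1 -> 0 < eta -> 0 < M -> 0 < P -> 0 < Rr ->
  0 <= N <= M ->
  eta * M * L2 * Rr = 1 / 4 ->
  a <= 1 / (L1 * eta * M * (P * 4)) ->
  a <= Rr / (eps1 * eta * M * (P * 4)) ->
  b <= Rr / (M * eta * (P * 4)) ->
  5 * (Rr / P) <= sigma ->
  N * (eta * (L2 * (3 / 5 * Rr) * (3 / 2 * sigma)
     + 2 * (a * (eps1 + L1 * (3 / 5 * Rr)) + b))) <= sigma / 2.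
Proof.
move=> L10 L20 a0 b0 e10 eta0 M0 P0 R0 /andP[N0 NM] eM ha1 ha2 hb hs.
have em0 : 0 < eta * M by rewrite mulr_gt0.
have h1 : eta * M * (a * (L1 * Rr)) <= Rr / P / 4.
  have -> : Rr / P / 4 = eta * M * (1 / (L1 * eta * M * (P * 4)) * (L1 * Rr)).
    by field; rewrite !gt_eqF.
  by rewrite ler_pM2l// ler_wpM2r// mulr_ge0// ltW.
have h2 : eta * M * (a * eps1) <= Rr / P / 4.
  have -> : Rr / P / 4 = eta * M * (Rr / (eps1 * eta * M * (P * 4)) * eps1).
    by field; rewrite !gt_eqF.
  by rewrite ler_pM2l// ler_wpM2r// ltW.
have h3 : eta * M * b <= Rr / P / 4.
  have -> : Rr / P / 4 = eta * M * (Rr / (M * eta * (P * 4))).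
    by field; rewrite !gt_eqF.
  by rewrite ler_pM2l.
have s0 : 0 <= sigma by apply: le_trans hs; rewrite mulr_ge0// divr_ge0// ltW.
have X0 : 0 <= eta * (L2 * (3 / 5 * Rr) * (3 / 2 * sigma) + 2 * (a * (eps1 + L1 * (3 / 5 * Rr)) + b)).
  have p1 := ltW L10; have p2 := ltW L20; have p3 := ltW R0; have p4 := ltW e10.
  apply: mulr_ge0; first exact: ltW.
  by rewrite addr_ge0// mulr_ge0// ?addr_ge0// ?mulr_ge0// ?addr_ge0// ?mulr_ge0// ?divr_ge0.
apply: le_trans (ler_wpM2r X0 NM) _.
have -> : M * (eta * (L2 * (3 / 5 * Rr) * (3 / 2 * sigma) + 2 * (a * (eps1 + L1 * (3 / 5 * Rr)) + b)))
  = 9 / 10 * (eta * M * L2 * Rr) * sigma + 2 * (eta * M * (a * eps1))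
    + 6 / 5 * (eta * M * (a * (L1 * Rr))) + 2 * (eta * M * b) by field.
rewrite eM; move: hs h1 h2 h3; set Q := Rr / P.
by move: (eta * M * (a * eps1)) (eta * M * (a * (L1 * Rr))) (eta * M * b) => x y z; lra.
Qed.

(** From [2 ^ el <= 1 + el] one gets [2 ^ gamma <= (1 + el) ^ (N + 1)], and dropping one factor
    costs at most 2. So the right-hand side is at least [5 / 2 * Rr]. *)
Lemma escape_growth (gamma Rr sigma el : R) (N : nat) :
  0 < Rr -> 0 <= el <= 1 -> gamma <= el * N.+1%:R ->
  5 * (Rr / 2 `^ gamma) <= sigma ->
  4 * (3 / 5 * Rr) < sigma * (1 + el) ^+ N.
Proof.
move=> R0 /andP[el0 el1] hg hs; set P := 2 `^ gamma in hs *.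
have P0 : 0 < P by apply: powR_gt0.
have grow : P <= (1 + el) ^+ N.+1.
  apply: (@le_trans _ _ ((2 `^ el) ^+ N.+1)).
    by rewrite -powR_mulrn ?powR_ge0// -powRrM ler_powR// ler1n.
  by apply: lerXn2r; rewrite ?nnegrE ?powR_ge0 ?addr_ge0// powR2_le1Dx// el0.
have half : P / 2 <= (1 + el) ^+ N.
  rewrite ler_pdivrMr//; apply: le_trans grow _; rewrite exprSr.
  by apply: ler_wpM2l; [rewrite exprn_ge0// addr_ge0|lra].
apply: (@lt_le_trans _ _ (5 * (Rr / P) * (P / 2))).
  have -> : 5 * (Rr / P) * (P / 2) = 5 / 2 * Rr by field; rewrite gt_eqF.
  by lra.
apply: ler_pM => //; first by rewrite mulr_ge0// divr_ge0// ltW.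
by rewrite divr_ge0// ltW.
Qed.

(** The hypotheses force [V >= 23/50 eps1], as [(1/2 - 1/64) / (1 + 1/20) > 23/50]; the [b] term is
    then negligible. *)
Lemma large_gradient_budget (a b eps1 V eta : R) : 0 <= a <= 1 / 20 -> 0 <= b <= eps1 / 64 ->
  0 < eta -> 0 <= V -> eps1 / 2 <= (1 + a) * V + b ->
  (1 - a) * eta * eps1 ^+ 2 / 256 <= eta * ((1 - a) / 4 * V ^+ 2 - 6 * b ^+ 2).
Proof.
move=> /andP[a0 a20] /andP[b0 be] eta0 V0 hV.
have aV : a * V <= 1 / 20 * V by rewrite ler_wpM2r.
have V46 : 23 / 50 * eps1 <= V by lra.
have e0 : 0 <= eps1 by lra.
have V2 : (23 / 50 * eps1) ^+ 2 <= V ^+ 2 by rewrite ler_sqr ?nnegrE//; lra.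
have b2 : b ^+ 2 <= (eps1 / 64) ^+ 2 by rewrite ler_sqr ?nnegrE//; lra.
have -> : (1 - a) * eta * eps1 ^+ 2 / 256 = eta * ((1 - a) / 256 * eps1 ^+ 2) by field.
apply: ler_wpM2l; first exact: ltW.
have V3 : (1 - a) / 4 * (23 / 50 * eps1) ^+ 2 <= (1 - a) / 4 * V ^+ 2.
  by apply: ler_wpM2l => //; lra.
have aE : a * eps1 ^+ 2 <= 1 / 20 * eps1 ^+ 2 by rewrite ler_wpM2r// sqr_ge0.
have E0 := sqr_ge0 eps1.
move: V3 b2 aE E0; rewrite !exprMn; move: (V ^+ 2) (b ^+ 2) (eps1 ^+ 2) => v2 bb e2.
by rewrite !expr2; lra.
Qed.

End EscapeEstimates.

(** * Escape probability and the main theorem *)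

Section Assembly.
Context {R : realType} {d : nat}.

Lemma natr_ceil_itv (y : R) : 0 <= y -> y <= (`|Num.ceil y|%N)%:R < y + 1.
Proof.
move=> y0; have c0 : 0 <= Num.ceil y by rewrite ceil_ge0 (lt_le_trans _ y0)// ltrN10.
have -> : (`|Num.ceil y|%N)%:R = (Num.ceil y)%:~R :> R by rewrite natr_absz ger0_norm.
by have /andP[h ->] := ceil_itv y; rewrite -ltrBlDr; move: h; rewrite intrB.
Qed.

(** Bernoulli's inequality, proved with [minn n T0] because all factors from index [T0] on equal
    1. *)
Lemma prod_truncated_ge (p : R) (T0 n : nat) : 0 <= p <= 1 ->
  1 - T0%:R * p <= \prod_(t < n) (1 - (if (t < T0)%N then p else 0)).
Proof.
move=> /andP[p0 p1].
suff H : 1 - (minn n T0)%:R * p <= \prod_(t < n) (1 - (if (t < T0)%N then p else 0)).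
  apply: le_trans H; rewrite lerD2l lerN2 ler_wpM2r// ler_nat; exact: geq_minr.
elim: n => [|n IH]; first by rewrite big_ord0 min0n mul0r subr0.
rewrite big_ord_recr/=; have [nT|Tn] := ltnP n T0; last first.
  by rewrite subr0 mulr1 (minn_idPr _) ?(leq_trans Tn)//; rewrite (minn_idPr Tn) in IH.
rewrite (minn_idPl nT); rewrite (minn_idPl (ltnW nT)) in IH.
have q0 : 0 <= 1 - p by rewrite subr_ge0.
apply: le_trans (ler_wpM2r q0 IH).
have : 0 <= n%:R * p * p by rewrite !mulr_ge0.
by rewrite -[n.+1%:R]natr1; lra.
Qed.

Lemma small_oracle_gradient (g : 'rV[R]_d -> R^o) G (a b eps1 : R) x :
  0 <= a <= 1 / 20 -> b <= eps1 / 64 -> inexact_oracle g G a b ->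
  enorm (G x) <= eps1 / 2 -> 0 <= enorm (grad g x) <= 11 / 20 * eps1.
Proof.
move=> /andP[a0 a20] be orc Gx; rewrite enorm_ge0/=; set V := enorm (grad g x).
have V0 : 0 <= V := enorm_ge0 _.
have h1 : V <= enorm (G x) + (a * V + b).
  have e : V = enorm (G x + (grad g x - G x)) by rewrite addrC subrK.
  rewrite {1}e.
  by apply: le_trans (ler_enormD _ _) _; rewrite lerD2l; exact: orc.
have : a * V <= 1 / 20 * V by rewrite ler_wpM2r.
by lra.
Qed.

Lemma stuck_set_thin (g : 'rV[R]_d -> R^o) G
    (L1 L2 alpha beta a b eps1 eps2 gamma : R) x (N : nat) :
  let F := F_par gamma a L2 eps2 in
  let Rr := R_par gamma L2 eps2 in
  let eta := eta_par a L1 in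
  let r := r_par gamma L1 L2 eps1 eps2 in
  let M := M_par gamma a L1 eps2 in
  (0 < d)%N -> 0 < L1 -> 0 < beta -> 0 < L2 -> 24 <= gamma ->
  assumption_A1 g L1 -> assumption_A2 g alpha beta L2 -> borel_measurable G ->
  0 <= a <= 1 / 20 -> 0 <= b -> inexact_oracle g G a b ->
  0 < eps1 <= alpha -> 0 < eps2 < L1 -> eps2 <= 4 * gamma * beta * L2 ->
  a <= 1 / (L1 * eta * M * (2 `^ gamma * 4)) ->
  a <= Rr / (eps1 * eta * M * (2 `^ gamma * 4)) ->
  b <= eps1 / 64 ->
  eta * M * b ^+ 2 <= F / 40 ->
  b <= Rr / (M * eta * (2 `^ gamma * 4)) ->
  M <= N.+1%:R < M + 1 ->
  enorm (G x) <= eps1 / 2 -> ~ second_order_critical g eps1 eps2 x ->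
  (iint (fun u : 'rV[R]_d => (\1_(stuck_set g G eta r F N.+1 x) u)%:E) <=
   (4 * (5 * Rr / (2 `^ gamma * eta) * Num.sqrt d%:R / r))%:E *
     iint (fun u : 'rV[R]_d => (\1_(cball 0 r) u)%:E))%E.
Proof.
move=> F Rr eta r M d0 L10 be0 L20 g24 A1 A2 mG a20 b0 orc /andP[e10 e1a] /andP[e20 e2L1]
  e2b ha1 ha2 hb64 hbF hbR /andP[MN NM] Gx nsoc.
have [_ [dg lip]] := A1; have /andP[a0 a20'] := a20.
have g0 : 0 < gamma by apply: lt_le_trans g24; rewrite ltr0n.
have eta0 : 0 < eta := eta_par_gt0 L10 a20.
have M0 : 0 < M := M_par_gt0 L10 a20 e20 g0.
have F0 : 0 < F := F_par_gt0 L20 a20 e20 g0.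
have R0 : 0 < Rr := R_par_gt0 L20 e20 g0.
have r0 : 0 < r := r_par_gt0 L10 L20 e10 e20 g0.
have P0 : 0 < 2 `^ gamma :> R by apply: powR_gt0.
have etaK : eta * L1 * (1 + a) ^+ 2 = 1 - a := eta_par_step L10 a20.
have etaL1' : eta * L1 <= 1 by exact: (etaL1_le1 L10 a0 eta0 etaK).
have eM : eta * M = gamma / eps2 by apply: eta_M_par.
have gx := small_oracle_gradient a20 hb64 orc Gx.
have gx1 : enorm (grad g x) <= eps1.
  by have /andP[_ h] := gx; apply: le_trans h _; lra.
have [v [lam [v1 /andP[lam1 lam2] Hv contr lin]]] :=
  strict_saddle d0 L10 be0 L20 eta0 etaL1' e1a e20 A1 A2 gx1 nsoc.
have lam0 : 0 < lam by exact: lt_trans lam1.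
(* The bound on [eps2] in terms of [beta] says that [Rr <= beta]: the confinement ball lies where
   the Hessian is Lipschitz. *)
have rhob : 3 / 5 * Rr <= beta.
  have : Rr <= beta.
    rewrite /Rr /R_par mulf_div mul1r ler_pdivrMr ?mulr_gt0//.
    by apply: le_trans e2b _; rewrite le_eqVlt; apply/orP; left; apply/eqP; ring.
  by lra.
have cg : continuous g by move=> y; exact: differentiable_continuous.
have budget u : enorm u <= r -> g x - F < g (perturbed_gd G eta x u N.+1) ->
    forall n, (n <= N.+1)%N -> enorm (perturbed_gd G eta x u n - x) <= 3 / 5 * Rr.
  move=> ur stuck n nN.
  apply: (perturbed_gd_localized L10 a0 a20' b0 eta0 etaK dg lip orc _ (ltW r0) ur _ stuck nN).
    by rewrite mulr_gt0.
  apply: (@localization_budget _ L1 eps1 eta M F Rr) => //.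
  - by apply: le_trans g24 _; apply: gamma_le_M_par => //; exact: ltW.
  - by rewrite ler0n/= ltW.
  - exact: ltW.
  - exact: M_F_par.
  - exact: eta_r_eps1_par.
  - by apply: eta_r2_par => //; [apply: le_trans g24; rewrite ler1n|exact: ltW].
apply: (@thin_volume R d (stuck_set g G eta r F N.+1 x) v r) => //.
- by apply: divr_gt0; apply: mulr_gt0 => //; rewrite ltr0n.
- exact: measurable_stuck_set.
- by move=> u [].
move=> u u' s [Bu su] [Bu' su'] uu'; rewrite ltNge; apply/negP => ws.
have ur : enorm u <= r by move: Bu; rewrite /cball/= subr0.
have u'r : enorm u' <= r by move: Bu'; rewrite /cball/= subr0.
have hs : 5 * (Rr / 2 `^ gamma) <= eta * `|s|.
  apply: le_trans (ler_wpM2l (ltW eta0) ws).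
  by rewrite le_eqVlt; apply/orP; left; apply/eqP; field; rewrite !gt_eqF.
have NM' : 0 <= (N%:R : R) <= M.
  apply/andP; split; first exact: ler0n.
  by move: NM; rewrite -[N.+1%:R]natr1 ltrD2r => /ltW.
have eMLR : eta * M * L2 * Rr = 1 / 4.
  by rewrite eM /Rr /R_par; field; rewrite !gt_eqF.
have small := escape_small L10 L20 a0 b0 e10 eta0 M0 P0 R0 NM' eMLR ha1 ha2 hbR hs.
have := perturbed_gd_gap (ltW L10) (ltW L20) a0 b0 eta0 lam0 lip orc gx1 v1 Hv contr
  (fun y z => lin (3 / 5 * Rr) y z rhob) (budget u ur su) (budget u' u'r su') uu' small.
apply/negP; rewrite -ltNge; apply: (@escape_growth _ gamma) => //.
  rewrite mulr_ge0 ?(ltW eta0) ?(ltW lam0)//=; apply: le_trans etaL1'.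
  by rewrite ler_pM2l.
(* The middle term equals [gamma]; the rest follows from [eps2 < lam] and [M <= N + 1]. *)
apply: (@le_trans _ _ (eta * eps2 * M)).
  by rewrite mulrAC eM divfK ?gt_eqF.
apply: ler_pM => //; [by rewrite mulr_ge0 ?ltW|exact: ltW|by rewrite ler_pM2l// ltW].
Qed.

End Assembly.

Theorem theorem1 (R : realType) (d : nat) (g : 'rV[R]_d -> R^o)
    (G : 'rV[R]_d -> 'rV[R]_d) (L1 L2 alpha beta a b delta eps1 eps2 Dg : R)
    (x0 : 'rV[R]_d) :
  0 < L1 -> 0 < alpha -> 0 < beta -> 0 < L2 ->
  assumption_A1 g L1 ->
  assumption_A2 g alpha beta L2 ->
  borel_measurable G ->
  0 <= a -> 0 <= b -> inexact_oracle g G a b ->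
  g x0 - inf (range g) <= Dg ->
  0 < delta < 1 ->
  0 < eps1 < alpha ->
  let gamma := gamma_par (phi_par d L1 L2 eps1 eps2 delta Dg) in
  let F := F_par gamma a L2 eps2 in
  let Rr := R_par gamma L2 eps2 in
  let eta := eta_par a L1 in
  let r := r_par gamma L1 L2 eps1 eps2 in
  let M := M_par gamma a L1 eps2 in
  0 < eps2 < Num.min (4 * gamma * beta * L2) (Num.min L1 (L1 ^+ 2)) ->
  a <= 1 / 20 ->
  a <= 1 / (L1 * eta * M * 2 `^ (gamma + 2)) ->
  a <= Rr / (eps1 * eta * M * 2 `^ (gamma + 2)) ->
  b <= eps1 / 64 ->
  b <= Num.sqrt (F / (40 * eta * M)) ->
  b <= Num.sqrt (L1 * F / (M * (5 * L1 + 1))) ->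
  b <= Rr / (M * eta * 2 `^ (gamma + 2)) ->
  let T := T_par Dg M F a eta eps1 in
  ((1 - delta)%:E <=
   unif_ball_seq_prob r T
     [set w | exists t : nat, (t <= T)%N /\
        second_order_critical g eps1 eps2 (pigd_iterate G eta M eps1 x0 w t)])%E.
Proof.
move=> L10 al0 be0 L20 A1 A2 mG a0 b0 orc gDg dl01 /andP[e10 e1a] gamma F Rr eta r M
  e2 ha20 ha1 ha2 hb64 hbF _ hbR.
set T := T_par _ _ _ _ _ _; lazy zeta.
have a20 : 0 <= a <= 1 / 20 by rewrite a0.
have a1 : 0 < 1 - a by lra.
move: e2; rewrite !lt_min => /andP[e20 /andP[e2b /andP[e2L1 _]]].
(* In dimension 0, [phi = 0], and the convention [ln 0 = 0] gives [gamma = 0], so that the upper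
   bound on [eps2] would be 0. *)
have d0 : (0 < d)%N.
  rewrite lt0n; apply/eqP => dz; move: e2b.
  rewrite /gamma dz /phi_par sqrtr0 mulr0 mul0r /gamma_par mul0r /log2 ln0// mul0r.
  by rewrite mulr0 !mul0r; move: e20; case: ltgtP.
have [[m gm] [dg lip]] := A1.
have infg x : inf (range g) <= g x.
  by apply: ge_inf; [exists m => _ [y _ <-]|exists x].
have Dg0 : 0 <= Dg by apply: le_trans gDg; rewrite subr_ge0.
have g24 : 24 <= gamma by apply: gamma_par_ge24.
have g0 : 0 < gamma by apply: lt_le_trans g24; rewrite ltr0n.
have eta0 : 0 < eta := eta_par_gt0 L10 a20.
have M0 : 0 < M := M_par_gt0 L10 a20 e20 g0.
have F0 : 0 < F := F_par_gt0 L20 a20 e20 g0.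
have R0 : 0 < Rr := R_par_gt0 L20 e20 g0.
have r0 : 0 < r := r_par_gt0 L10 L20 e10 e20 g0.
have P0 : 0 < 2 `^ gamma :> R by apply: powR_gt0.
have etaK : eta * L1 * (1 + a) ^+ 2 = 1 - a := eta_par_step L10 a20.
have P4 : 2 `^ (gamma + 2) = 2 `^ gamma * 4 :> R.
  rewrite powRD; last by rewrite pnatr_eq0 implybT.
  by congr (_ * _); rewrite (powR_mulrn 2%N (ler0n R 2)); ring.
rewrite P4 in ha1 ha2 hbR.
have hbF' : eta * M * b ^+ 2 <= F / 40.
  have q0 : 0 <= F / (40 * eta * M).
    by apply: divr_ge0; [exact: ltW|apply: mulr_ge0; [apply: mulr_ge0; [exact: ler0n|exact: ltW]|exact: ltW]].
  have : b ^+ 2 <= F / (40 * eta * M).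
    by rewrite -(sqr_sqrtr q0) ler_sqr ?nnegrE ?sqrtr_ge0.
  move=> /(ler_wpM2l (ltW (mulr_gt0 eta0 M0))) h; apply: le_trans h _.
  by rewrite le_eqVlt; apply/orP; left; apply/eqP; field; rewrite !gt_eqF.
have M1 : 1 <= M.
  apply: (@le_trans _ _ gamma); first by apply: le_trans g24; rewrite ler1n.
  by apply: gamma_le_M_par => //; exact: ltW.
have [N MN] : exists N : nat, M <= N.+1%:R < M + 1.
  have := natr_ceil_itv (ltW M0); case: (`|_|%N) => [|N h]; last by exists N.
  by move=> /andP[/(lt_le_trans M0)]; rewrite ltxx.
pose mx := Num.max (2 * M / F) (256 / ((1 - a) * eta * eps1 ^+ 2)).
have mx1 : 2 * M / F <= mx by rewrite le_max lexx.
have mx2 : 256 / ((1 - a) * eta * eps1 ^+ 2) <= mx by rewrite le_max lexx orbT.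
have mx0 : 0 < mx.
  by apply: lt_le_trans mx1; apply: divr_gt0 => //; apply: mulr_gt0.
(* The least integer above [Dg * mx]: a decrease of [1 / mx] per step then exceeds [Dg] in total. *)
pose T0 := (Num.truncn (Dg * mx)).+1.
have /andP[T0u T0l] : (Num.truncn (Dg * mx))%:R <= Dg * mx < T0%:R.
  by apply: truncn_itv; rewrite mulr_ge0// ltW.
have T0T : (T0 <= T)%N.
  rewrite -(ler_nat R) /T0 -natr1; apply: le_trans (lerD T0u (lexx 1)) _.
  have y0 : 0 <= 8 * Dg * mx + 4 * M.
    by apply: addr_ge0; [apply: mulr_ge0; [exact: mulr_ge0|exact: ltW]|rewrite mulr_ge0// ltW].
  have /andP[h _] := natr_ceil_itv y0.
  apply: le_trans h; have := mulr_ge0 Dg0 (ltW mx0); lra.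
pose p := 4 * (5 * Rr / (2 `^ gamma * eta) * Num.sqrt d%:R / r).
have pT : p * (Dg * mx + 1) <= delta by apply: failure_budget.
have sq0 : 0 < Num.sqrt d%:R :> R by rewrite sqrtr_gt0 ltr0n.
have p0 : 0 < p.
  apply: mulr_gt0; first exact: ltr0n.
  by apply: divr_gt0 => //; apply: mulr_gt0 => //; apply: divr_gt0; apply: mulr_gt0.
have pT0 : T0%:R * p <= delta.
  apply: le_trans pT; rewrite mulrC ler_pM2l// /T0 -natr1 lerD2r//.
have /andP[dl0 dl1] := dl01.
have p1 : p <= 1.
  apply: le_trans (ltW dl1); apply: le_trans pT0.
  by rewrite ler_peMl ?(ltW p0)// ler1n.
have cg : continuous g by move=> y; exact: differentiable_continuous.
(* All conditions depend on draws before [t] only. Noncriticality is included because thinness is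
   known only at strict saddles, and [t < T0] limits the charged steps. *)
pose fails w t := (t < T0)%N /\ triggers G eta M eps1 x0 w t /\
  ~ second_order_critical g eps1 eps2 (pigd_iterate G eta M eps1 x0 w t).
pose bad t w : set (borelV d) := if `[<fails w t>]
  then stuck_set g G eta r F N.+1 (pigd_iterate G eta M eps1 x0 w t) else set0.
pose pt t := if (t < T0)%N then p else 0.
have pt01 t : 0 <= pt t <= 1 by rewrite /pt; case: ifP => _; rewrite ?lexx ?ler01// (ltW p0).
apply: (@le_trans _ _ ((1 * \prod_(t < T) (1 - pt t))%:E)).
  rewrite mul1r lee_fin; apply: le_trans (prod_truncated_ge T0 T _); last by rewrite (ltW p0).
  by rewrite lerD2l lerN2.
apply: (@unif_ball_seq_exp_ge _ _ r T bad pt) => //.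
- move=> t w; rewrite /bad; case: asboolP => _; last exact: measurable0.
  exact: measurable_stuck_set.
- by move=> t w; rewrite /bad; case: asboolP => _ // u [].
- move=> t w; rewrite /bad; case: asboolP => [[tT0 [/andP[Gx _] nsoc]]|_]; last first.
    rewrite (_ : (fun u => _) = (fun=> 0%E)) ?iint0; last first.
      by apply/funext => u; rewrite indic0.
    apply: mule_ge0; first by rewrite lee_fin; have /andP[] := pt01 t.
    by apply: iint_ge0 => u; rewrite lee_fin.
  rewrite /pt tT0; apply: (@stuck_set_thin R d g G L1 L2 alpha beta a b eps1 eps2 gamma) => //.
  + by rewrite e10 ltW.
  + by rewrite e20.
  + exact: ltW.
- move=> t w w' ww'; rewrite /bad /fails (triggers_past _ _ _ _ _ ww').
  by rewrite /pigd_iterate (pigd_state_past _ _ _ _ _ ww').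
move=> w good; rewrite lee_fin indicE mem_set//=; apply: contrapT => nogood.
have nsoc t : (t <= T)%N -> ~ second_order_critical g eps1 eps2 (pigd_iterate G eta M eps1 x0 w t).
  by move=> tT sc; apply: nogood; exists t.
pose rate := mx^-1.
have rate0 : 0 <= rate by rewrite invr_ge0 ltW.
(* An epoch has [N + 1 < M + 1 <= 2 M] steps, which explains the factor 2 in [2 * M / F]. *)
have rateF : rate * N.+1%:R <= F.
  rewrite mulrC ler_pdivrMr//; apply: (@le_trans _ _ (2 * M)).
    by have /andP[_ /ltW h] := MN; apply: le_trans h _; rewrite mulr_natl mulr2n lerD2l.
  by rewrite [leRHS]mulrC -ler_pdivrMr.
have rateG : rate <= (1 - a) * eta * eps1 ^+ 2 / 256.
  have D0 : 0 < (1 - a) * eta * eps1 ^+ 2.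
    apply: mulr_gt0; last exact: exprn_gt0.
    exact: mulr_gt0.
  have c0 : 0 < 256 :> R by rewrite ltr0n.
  rewrite -[_ / 256]invf_div /rate lef_pV2; [exact: mx2|by rewrite posrE|].
  by rewrite posrE; exact: divr_gt0 c0 D0.
have large x : eps1 / 2 < enorm (G x) -> g (gd_step G eta x) <= g x - rate.
  move=> Gx; have u0 : enorm (0 : 'rV[R]_d) <= 0 by rewrite enorm0.
  have := perturbed_step L10 a0 ha20 b0 eta0 etaK dg lip orc x (lexx 0) u0.
  rewrite addr0 -/(gd_step G eta x) => h; apply: le_trans h _.
  rewrite lerD2l lerN2; apply: le_trans rateG _.
  rewrite mulr0 mul0r expr0n/= !subr0.
  apply: large_gradient_budget => //; [by rewrite b0|exact: enorm_ge0|].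
  have := enorm_oracle_dir orc x u0; rewrite !addr0; exact: le_trans (ltW Gx).
have small n : (n < T0)%N -> triggers G eta M eps1 x0 w n ->
    g (perturbed_gd G eta (pigd_iterate G eta M eps1 x0 w n) (w n) N.+1) <=
    g (pigd_iterate G eta M eps1 x0 w n) - F.
  move=> nT0 tr; have nT : (n < T)%N by exact: leq_trans T0T.
  have [Bw nbad] := good n nT; rewrite leNgt; apply/negP => stuck; apply: nbad.
  rewrite /bad asboolT//; split=> //; split=> //.
  by apply: nsoc; exact: ltnW.
have [n] := pigd_descent MN (ltn0Sn N) rate0 rateF large small.
apply/negP; rewrite -ltNge; apply: lt_le_trans (infg _).
have : Dg < rate * T0%:R by rewrite mulrC ltr_pdivlMr.
by move: gDg; lra.
Qed.
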